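(* Let $\epsilon>0$ be fixed and let $p=p(n)$ satisfy $1\gg p\ge n^{-\frac14+\epsilon}$ as $n\to\infty$. Then, with high probability, uniformly over all $\mathbf u\in[0,1]^n$ with $\sum_{i\in[n]}u_i=\Omega(n)$, the following hold: (a) $\displaystyle\chi(\mathbf G_p^{\times})=(1+o(1))\frac{p}{2\log(pn)}\max_{U\subseteq[n]}\frac1{|U|}\Big(\sum_{i\in U}u_i\Big)^2$, where $\mathbf G_p^\times\sim\mathcal M^\times(\mathbf u,p)$; (b) $\displaystyle\chi(\mathbf G_p^{+})=(1+o(1))\frac{p}{\log(pn)}\sum_{i\in[n]}u_i$, where $\mathbf G_p^+\sim\mathcal M^+(\mathbf u,p)$.
   Context: For $\mathbf u=(u_1,\dots,u_n)^T\in[0,1]^n$ and $p\in[0,1]$, $\mathcal M^\times(\mathbf u,p)$ is the random graph on $[n]$ where each pair $ij$ is an edge independently with probability $p\,u_iu_j$ (Chung–Lu model). For $p\in[0,\tfrac12]$, $\mathcal M^+(\mathbf u,p)$ is the random graph on $[n]$ where each pair $ij$ is an edge independently with probability $p(u_i+u_j)$. $\chi$ is the chromatic number, $\log$ natural logarithm. $a\gg b$ means $b=o(a)$; $a=\Omega(b)$ means $b=O(a)$ with $a>0$. ''With high probability'' means with probability tending to $1$ as $n\to\infty$; $X=(1+o(1))Y$ whp means for every fixed $\delta>0$, $(1-\delta)Y\le X\le(1+\delta)Y$ with probability tending to $1$. *)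

(* Defs.v *)
From HB Require Import structures.
From mathcomp Require Import all_boot all_order all_algebra.
Set Implicit Arguments.
Unset Strict Implicit.
Unset Printing Implicit Defensive.
Import Order.TTheory GRing.Theory Num.Theory.

Definition colorable (T : finType) (e : rel T) (k : nat) : bool :=
  [exists f : {ffun T -> 'I_k}, [forall x, forall y, e x y ==> (f x != f y)]].

(* #|T| colours always suffice for an irreflexive e, so the search may stop
   there; the value is meaningless when e has a loop. *)
Definition chromatic_number (T : finType) (e : rel T) : nat :=
  [arg min_(k < (ord_max : 'I_#|T|.+1) | colorable e k) (k : nat)].

Lemma colorable_card (T : finType) (e : rel T) :
  irreflexive e -> colorable e #|T|.
Proof.
move=> eirr; apply/existsP; exists [ffun x => enum_rank x].
apply/forallP => x; apply/forallP => y; apply/implyP => exy; rewrite !ffunE.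
by apply: contraTneq exy => /enum_rank_inj ->; rewrite eirr.
Qed.

Lemma chromatic_numberP (T : finType) (e : rel T) : irreflexive e ->
  colorable e (chromatic_number e) /\
  (forall k, colorable e k -> (chromatic_number e <= k)%N).
Proof.
move=> /colorable_card ce; rewrite /chromatic_number.
case: arg_minnP => // i ci imin; split=> // k ck.
have [kT|Tk] := leqP k #|T|; first exact: (imin (Ordinal (kT : k < #|T|.+1)%N)).
by apply: leq_trans (ltnW Tk); rewrite -ltnS.
Qed.

(* A graph on {0, ..., n-1} is given by its edge set G \subset vpairs n, the
   unordered pair {i, j} being represented by (i, j) with i < j. *)

Definition vpairs (n : nat) : {set 'I_n * 'I_n} := [set e : 'I_n * 'I_n | (e.1 < e.2)%N].

Definition adj (n : nat) (G : {set 'I_n * 'I_n}) : rel 'I_n :=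
  fun i j => ((i, j) \in G) || ((j, i) \in G).

Lemma adj_irr (n : nat) (G : {set 'I_n * 'I_n}) :
  G \subset vpairs n -> irreflexive (adj G).
Proof.
move=> /subsetP sG i; rewrite /adj orbb; apply/negP => /sG.
by rewrite inE ltnn.
Qed.

Definition chi (n : nat) (G : {set 'I_n * 'I_n}) : nat :=
  chromatic_number (adj G).

Local Open Scope ring_scope.

(* Law of the random graph in which the pairs ij, i < j, are edges
   independently, each with probability q i j; a probability law only when the
   q i j lie in [0, 1], which for the two models below holds if all u i are in
   [0, 1] and p is in [0, 1] (product), resp. [0, 1/2] (sum). *)

Definition graph_mass (R : numDomainType) (n : nat) (q : 'I_n -> 'I_n -> R)
    (G : {set 'I_n * 'I_n}) : R :=
  \prod_(e in vpairs n) (if e \in G then q e.1 e.2 else 1 - q e.1 e.2).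

Definition graph_prob (R : numDomainType) (n : nat) (q : 'I_n -> 'I_n -> R)
    (A : pred {set 'I_n * 'I_n}) : R :=
  \sum_(G in powerset (vpairs n) | A G) graph_mass q G.

Lemma graph_prob_edges (R : numDomainType) (n : nat) (q : 'I_n -> 'I_n -> R)
    (S : {set 'I_n * 'I_n}) : S \subset vpairs n ->
  graph_prob q (fun G => S \subset G) = \prod_(e in S) q e.1 e.2.
Proof.
move=> sS; rewrite /graph_prob /graph_mass.
pose F e := if e \in vpairs n then q e.1 e.2 else 0.
pose H e := if e \in vpairs n then (if e \in S then 0 else 1 - q e.1 e.2) else 1.
transitivity (\prod_e (F e + H e)); last first.
  rewrite [RHS]big_mkcond; apply: eq_bigr => e _; rewrite /F /H.
  have [eS|eS] := boolP (e \in S); first by rewrite (subsetP sS) // addr0.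
  by case: ifP => _; rewrite ?add0r // addrC subrK.
rewrite bigA_distr [LHS]big_mkcond; apply: eq_bigr => G _; rewrite inE.
have [sG|/subsetPn[e eG eV]] /= := boolP (G \subset vpairs n); last first.
  by rewrite (bigD1 e) //= eG /F (negbTE eV) mul0r.
have [sSG|/subsetPn[e eS eG]] := boolP (S \subset G); last first.
  by rewrite (bigD1 e) //= (negbTE eG) /H (subsetP sS) // eS mul0r.
rewrite [LHS]big_mkcond; apply: eq_bigr => e _; rewrite /F /H.
have [eG|eG] := boolP (e \in G); first by rewrite (subsetP sG).
by rewrite (negbTE (contra (subsetP sSG e) eG)).
Qed.

Lemma graph_probT (R : numDomainType) (n : nat) (q : 'I_n -> 'I_n -> R) :
  graph_prob q xpredT = 1.
Proof.
rewrite -[RHS](big_set0 1 *%R (fun e => q e.1 e.2)) -graph_prob_edges ?sub0set//.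
by apply: eq_bigl => G; rewrite sub0set.
Qed.

Definition model_times (R : numDomainType) (n : nat) (u : 'I_n -> R) (p : R)
    (A : pred {set 'I_n * 'I_n}) : R :=
  graph_prob (fun i j => p * u i * u j) A.

Definition model_plus (R : numDomainType) (n : nat) (u : 'I_n -> R) (p : R)
    (A : pred {set 'I_n * 'I_n}) : R :=
  graph_prob (fun i j => p * (u i + u j)) A.

(* All terms are nonnegative, so the starting value 0 of the big operator does
   not affect the maximum. *)
Definition max_density (R : realFieldType) (n : nat) (u : 'I_n -> R)
    : R :=
  \big[Num.max/0]_(U : {set 'I_n} | (0 < #|U|)%N)
     (#|U|%:R^-1 * (\sum_(i in U) u i) ^+ 2).

(* Main.v *)
Require Import Defs.
From mathcomp Require Import all_boot all_order all_algebra.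
From mathcomp Require Import all_classical all_reals all_analysis.
From mathcomp Require Import ring lra.
From mathcomp Require Import fintype finset.
Import Order.TTheory GRing.Theory Num.Theory.
Import numFieldNormedType.Exports.
Local Open Scope ring_scope.
Set Implicit Arguments.
Unset Strict Implicit.
Unset Printing Implicit Defensive.

(* Write L = ln (p n) and u(S) for the weight of a vertex set S.

   Lower bound.  By a first moment computation, with high probability every
   independent set S satisfies p u(S)^2 <= 2 (1 + d) L |S| in the product model
   and p u(S) <= (1 + d) L in the sum model.  Summing over the colour classes,
   with the Cauchy-Schwarz inequality in the product model, gives the bound.

   Upper bound.  Order the vertices by weight and cut them into s = n / k
   consecutive blocks of k = (1 + d/2) Y vertices.  By Janson's inequality, with
   probability 1 - e^(-n) every vertex set meeting each block in at least
   M = k / L^2 vertices contains an independent transversal of the blocks: the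
   overlap of two transversals is controlled because the energy of a set of
   blocks, measured by block maxima, is bounded by averages over the preceding
   blocks, hence by the definition of Y.  The overlaps of size two contribute
   (s / M)^2, which is o(1 / n) exactly because p >= n^(-1/4 + eps).  Removing
   k - M disjoint transversals leaves O(k + n / L^2) vertices, which span a
   sparse graph and need only o(Y) further colours. *)

(** The vertices still uncoloured during the extraction form a set V that depends on the graph, so
    an independent set must exist in every admissible V at once: this is the reason for asking
    failure probability e^(-n), against 2^n sets V. Taking one vertex per block makes admissibility
    a matter of block counts alone, and each extraction lowers every count by exactly one, which
    allows k - M rounds. Transversals have different probabilities of being independent. Janson's
    inequality is therefore used with weights inversely proportional to these probabilities; the
    correlation of two transversals then depends only on the blocks in which they agree. The choice
    M = k / L^2 balances two demands. On one side ln M = L - O(ln L), and this loss is absorbed by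
    the slack d L in the energy per block. On the other side the n / L^2 vertices left over cost O(p
    n / L^2) = O(Y / L) colours. *)

(** * Expectations over the random graph *)

Definition graph_mean (R : numDomainType) (n : nat) (q : 'I_n -> 'I_n -> R)
    (f : {set 'I_n * 'I_n} -> R) : R :=
  \sum_(G in powerset (vpairs n)) graph_mass q G * f G.

Definition edge_law (R : numDomainType) (n : nat) (q : 'I_n -> 'I_n -> R) : Prop :=
  forall i j, 0 <= q i j <= 1.

Definition absent (R : numDomainType) (n : nat) (D G : {set 'I_n * 'I_n}) : R :=
  [disjoint D & G]%:R.

Lemma graph_mass_ge0 (R : numDomainType) (n : nat) (q : 'I_n -> 'I_n -> R) G :
  edge_law q -> 0 <= graph_mass q G.
Proof.
move=> hq; apply: prodr_ge0 => e _; have /andP[q0 q1] := hq e.1 e.2.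
by case: ifP => // _; rewrite subr_ge0.
Qed.

Lemma graph_probE (R : numDomainType) (n : nat) (q : 'I_n -> 'I_n -> R)
    (A : pred {set 'I_n * 'I_n}) :
  graph_prob q A = graph_mean q (fun G => (A G)%:R).
Proof.
rewrite /graph_prob /graph_mean big_mkcondr; apply: eq_bigr => G _.
by case: (A G); rewrite ?mulr1 ?mulr0.
Qed.

Lemma graph_mean_le (R : numDomainType) (n : nat) (q : 'I_n -> 'I_n -> R)
    (f g : {set 'I_n * 'I_n} -> R) :
  edge_law q -> (forall G : {set 'I_n * 'I_n}, G \subset vpairs n -> f G <= g G) -> graph_mean q f <= graph_mean q g.
Proof.
move=> hq fg; apply: ler_sum => G; rewrite inE => sG.
by apply: ler_wpM2l; [exact: graph_mass_ge0|exact: fg].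
Qed.

Lemma eq_graph_mean (R : numDomainType) (n : nat) (q : 'I_n -> 'I_n -> R)
    (f g : {set 'I_n * 'I_n} -> R) :
  (forall G : {set 'I_n * 'I_n}, G \subset vpairs n -> f G = g G) -> graph_mean q f = graph_mean q g.
Proof. by move=> fg; apply: eq_bigr => G; rewrite inE => /fg ->. Qed.

Lemma graph_mean_scale (R : numDomainType) (n : nat) (q : 'I_n -> 'I_n -> R) a
    (f : {set 'I_n * 'I_n} -> R) :
  graph_mean q (fun G => a * f G) = a * graph_mean q f.
Proof. by rewrite /graph_mean mulr_sumr; apply: eq_bigr => G _; rewrite mulrCA. Qed.

Lemma graph_mean_sum (R : numDomainType) (n : nat) (q : 'I_n -> 'I_n -> R)
    (J : Type) (r : seq J) (P : pred J) (f : J -> {set 'I_n * 'I_n} -> R) :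
  graph_mean q (fun G => \sum_(j <- r | P j) f j G) = \sum_(j <- r | P j) graph_mean q (f j).
Proof.
by rewrite /graph_mean exchange_big /=; apply: eq_bigr => G _; rewrite mulr_sumr.
Qed.

Lemma graph_mean_sub (R : numDomainType) (n : nat) (q : 'I_n -> 'I_n -> R)
    (f g : {set 'I_n * 'I_n} -> R) :
  graph_mean q (fun G => f G - g G) = graph_mean q f - graph_mean q g.
Proof. by rewrite /graph_mean -sumrB; apply: eq_bigr => G _; rewrite mulrBr. Qed.

Lemma graph_mean1 (R : numDomainType) (n : nat) (q : 'I_n -> 'I_n -> R) :
  graph_mean q (fun=> 1) = 1.
Proof. by rewrite -[RHS](graph_probT q) graph_probE. Qed.

Lemma graph_mean_prod (R : numDomainType) (n : nat) (q : 'I_n -> 'I_n -> R)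
    (a : 'I_n * 'I_n -> R) (D : {set 'I_n * 'I_n}) : D \subset vpairs n ->
  graph_mean q (fun G => \prod_(e in D :&: G) a e) =
  \prod_(e in D) (1 - q e.1 e.2 + a e * q e.1 e.2).
Proof.
move=> sD.
(* Expanding the product of [F e + H e] sums over the set [G] of pairs that choose [F]; outside
   [vpairs n], [F] is 0 and [H] is 1, so only edge sets of graphs survive. *)
pose F e := if e \in vpairs n then (if e \in D then a e else 1) * q e.1 e.2 else 0.
pose H e := if e \in vpairs n then 1 - q e.1 e.2 else 1.
transitivity (\prod_e (F e + H e)); last first.
  rewrite [RHS]big_mkcond; apply: eq_bigr => e _; rewrite /F /H.
  have [eD|eD] := boolP (e \in D); first by rewrite (subsetP sD) // addrC.
  by case: ifP => _; rewrite ?add0r // mul1r addrC subrK.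
rewrite bigA_distr /graph_mean [LHS]big_mkcond; apply: eq_bigr => G _; rewrite inE.
have [sG|/subsetPn[e eG eV]] /= := boolP (G \subset vpairs n); last first.
  by rewrite (bigD1 e) //= eG /F (negbTE eV) mul0r.
rewrite /graph_mass [X in X * _]big_mkcond [X in _ * X]big_mkcond -big_split /=.
apply: eq_bigr => e _; rewrite /F /H in_setI.
have [eG|eG] := boolP (e \in G); last by rewrite andbF mulr1.
by rewrite (subsetP sG) // andbT mulrC.
Qed.

Lemma graph_mean_absent1 (R : numDomainType) (n : nat) (q : 'I_n -> 'I_n -> R)
    (e : 'I_n * 'I_n) (f : {set 'I_n * 'I_n} -> R) : e \in vpairs n ->
  graph_mean q (fun G => (e \notin G)%:R * f G) = (1 - q e.1 e.2) * graph_mean q (fun G => f (G :\ e)).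
Proof.
move=> eV; rewrite /graph_mean.
pose ms (G : {set _}) := \prod_(e' in vpairs n | e' != e)
  (if e' \in G then q e'.1 e'.2 else 1 - q e'.1 e'.2).
have massE G : graph_mass q G = (if e \in G then q e.1 e.2 else 1 - q e.1 e.2) * ms G.
  by rewrite /graph_mass (bigD1 e).
have msU G : ms (e |: G) = ms G.
  by apply: eq_bigr => e' /andP[_ ne]; rewrite !inE (negbTE ne).
(* Each graph without [e] is paired with the one that has [e] added; once [e] is deleted, [f] sees
   the same graph in both. *)
have split f' : \sum_(G in powerset (vpairs n)) f' G =
   \sum_(G in powerset (vpairs n) | e \notin G) (f' G + f' (e |: G)) :> R.
  rewrite (bigID (fun G : {set _} => e \notin G)) /= big_split /=; congr (_ + _).
  rewrite (reindex_onto (fun G => e |: G) (fun G => G :\ e)) /=; last first.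
    by move=> G /andP[_]; rewrite negbK => eG; rewrite setD1K.
  apply: eq_bigl => G; rewrite !inE eqxx /= andbT.
  have [eG|eG] := boolP (e \in G).
    rewrite andbF; apply/negbTE/negP => /andP[_ /eqP/setP/(_ e)].
    by rewrite !inE eqxx eG.
  rewrite setU1K // eqxx !andbT; apply/idP/idP => [|sG].
    by apply: subset_trans; rewrite subsetUr.
  by rewrite subUset sub1set eV.
rewrite split [in RHS]split mulr_sumr; apply: eq_bigr => G /andP[_ eG].
rewrite !massE msU setU11 (negbTE eG) /= mul0r mulr0 addr0 mul1r.
have -> : G :\ e = G by apply/setDidPl; rewrite disjoint_sym disjoints1.
by rewrite setU1K // -mulrDl -mulrDl subrK mul1r mulrA.
Qed.

(** By independence, conditioning on the absence of [D] leaves the law of the other pairs unchanged,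
    so [f] is averaged over graphs from which [D] is deleted. *)
Lemma graph_mean_absent (R : numDomainType) (n : nat) (q : 'I_n -> 'I_n -> R)
    (D : {set 'I_n * 'I_n}) (f : {set 'I_n * 'I_n} -> R) : D \subset vpairs n ->
  graph_mean q (fun G => absent R D G * f G) =
  (\prod_(e in D) (1 - q e.1 e.2)) * graph_mean q (fun G => f (G :\: D)).
Proof.
have [m] := ubnP #|D|; elim: m => // m IH in D f *; rewrite ltnS => Dm sD.
have [->|[e eD]] := set_0Vmem D.
  rewrite big_set0 mul1r; apply: eq_graph_mean => G _.
  by rewrite /absent -setI_eq0 set0I eqxx mul1r setD0.
have sD' : D :\ e \subset vpairs n by exact: subset_trans (subD1set _ _) sD.
rewrite (big_setD1 e eD) /= -mulrA -[in RHS]mulrCA.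
transitivity (graph_mean q (fun G => (e \notin G)%:R * (absent R (D :\ e) G * f G))).
  apply: eq_graph_mean => G _; rewrite mulrA; congr (_ * _); rewrite /absent -natrM mulnb.
  congr (_%:R); congr nat_of_bool.
  rewrite -!setI_eq0 -[in LHS](setD1K eD) setIUl setU_eq0.
  by rewrite setI_eq0 disjoints1.
rewrite graph_mean_absent1 ?(subsetP sD) // mulrCA; congr (_ * _).
transitivity (graph_mean q (fun G => absent R (D :\ e) G * f (G :\ e))).
  apply: eq_graph_mean => G _; congr (_%:R * _); congr nat_of_bool.
  rewrite -!setI_eq0; congr (_ == _); apply/setP => x; rewrite !inE.
  by case: (x == e); rewrite ?andbF.
rewrite IH //; last by apply: leq_trans Dm; rewrite [X in (_ < X)%N](cardsD1 e) eD.
congr (_ * _); apply: eq_graph_mean => G _; congr f; apply/setP => x; rewrite !inE.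
by case: eqP => [->|]; rewrite ?eD.
Qed.

Lemma prob_absent (R : numDomainType) (n : nat) (q : 'I_n -> 'I_n -> R)
    (D : {set 'I_n * 'I_n}) : D \subset vpairs n ->
  graph_mean q (absent R D) = \prod_(e in D) (1 - q e.1 e.2).
Proof.
move=> sD; have := graph_mean_absent q (fun=> 1) sD; rewrite graph_mean1 mulr1 => <-.
by apply: eq_graph_mean => G _; rewrite mulr1.
Qed.

(** * Janson's inequality *)

Lemma absent_ge0 (R : numDomainType) (n : nat) (D G : {set 'I_n * 'I_n}) :
  0 <= absent R D G.
Proof. exact: ler0n. Qed.

Lemma absent_le1 (R : numDomainType) (n : nat) (D G : {set 'I_n * 'I_n}) :
  absent R D G <= 1.
Proof. by rewrite /absent; case: [disjoint _ & _]; rewrite ?ler01. Qed.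

(** Weierstrass's product inequality. The induction carries the sign of the sum s to make the cross
    term of (1 - a)(1 - s) nonnegative. *)
Lemma prod_one_sub_ge (R : numDomainType) (J : Type) (r : seq J) (P : pred J)
    (a : J -> R) : (forall j, P j -> 0 <= a j <= 1) ->
  1 - \sum_(j <- r | P j) a j <= \prod_(j <- r | P j) (1 - a j).
Proof.
move=> ha; have [] : (0 <= \sum_(j <- r | P j) a j) /\
    (1 - \sum_(j <- r | P j) a j <= \prod_(j <- r | P j) (1 - a j) <= 1).
  elim: r => [|j r [IH0 /andP[IH1 IH2]]]; first by rewrite !big_nil subr0 !lexx.
  rewrite !big_cons; case: ifP => [Pj|_]; last by split=> //; rewrite IH1.
  have /andP[a0 a1] := ha j Pj; have b0 : 0 <= 1 - a j by rewrite subr_ge0.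
  split; first exact: addr_ge0.
  apply/andP; split; last first.
    by rewrite -[leRHS]mulr1 (le_trans (ler_wpM2l b0 IH2)) // ler_wpM2r // gerBl.
  apply: le_trans (ler_wpM2l b0 IH1); rewrite mulrBr mulr1 mulrBl mul1r.
  rewrite opprD opprB addrA lerD2l lerBrDr; rewrite addrC subrr.
  exact: mulr_ge0.
by move=> _ /andP[].
Qed.

(* Only events sharing an edge with event i need the linear bound: for the
   others, deleting the edges of event i does not change the product, and
   deleting the edges of D_i \cup D_j can only decrease it. *)
Lemma janson_step (R : numDomainType) (n : nat) (q : 'I_n -> 'I_n -> R)
    (J : finType) (D : J -> {set 'I_n * 'I_n}) (x : J -> R) (i : J) (r : seq J) :
  edge_law q -> (forall j, D j \subset vpairs n) -> (forall j, 0 <= x j <= 1) ->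
  graph_mean q (fun G => \prod_(j <- r | [disjoint D i & D j]) (1 - x j * absent R (D j) G)) *
    (\prod_(e in D i) (1 - q e.1 e.2)
     - \sum_(j <- r | ~~ [disjoint D i & D j])
         x j * \prod_(e in D i :|: D j) (1 - q e.1 e.2))
  <= graph_mean q (fun G => absent R (D i) G * \prod_(j <- r) (1 - x j * absent R (D j) G)).
Proof.
move=> hq sD hx.
set C := fun G : {set 'I_n * 'I_n} =>
  \prod_(j <- r | [disjoint D i & D j]) (1 - x j * absent R (D j) G).
have xa01 j G : 0 <= x j * absent R (D j) G <= 1.
  have /andP[x0 x1] := hx j; rewrite mulr_ge0 ?absent_ge0 //=.
  by rewrite -[leRHS]mulr1 ler_pM // ?absent_ge0 // absent_le1.
have C0 G : 0 <= C G by apply: prodr_ge0 => j _; rewrite subr_ge0; have /andP[] := xa01 j G.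
pose B G := \sum_(j <- r | ~~ [disjoint D i & D j]) x j * absent R (D j) G.
apply: (@le_trans _ _ (graph_mean q (fun G => absent R (D i) G * (C G * (1 - B G))))); last first.
  apply: graph_mean_le => // G _; apply: ler_wpM2l; first exact: absent_ge0.
  rewrite (bigID (fun j => [disjoint D i & D j])) /=; apply: ler_wpM2l => //.
  by apply: prod_one_sub_ge.
have -> : graph_mean q (fun G => absent R (D i) G * (C G * (1 - B G))) =
  graph_mean q (fun G => absent R (D i) G * C G) -
  \sum_(j <- r | ~~ [disjoint D i & D j])
     x j * graph_mean q (fun G => absent R (D i :|: D j) G * C G).
  under eq_bigr => j _ do rewrite -graph_mean_scale.
  rewrite -graph_mean_sum -graph_mean_sub; apply: eq_graph_mean => G _.
  rewrite mulrBr mulr1 mulrBr; congr (_ - _); rewrite /B !mulr_sumr; apply: eq_bigr => j _.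
  rewrite [absent R (D i :|: D j) G]/absent.
  have -> : [disjoint D i :|: D j & G] = [disjoint D i & G] && [disjoint D j & G].
    by rewrite -!setI_eq0 setIUl setU_eq0.
  by rewrite -mulnb natrM -!/(absent _ _ _); ring.
rewrite mulrBr lerB //.
  rewrite graph_mean_absent // mulrC; apply: ler_wpM2l.
    by apply: prodr_ge0 => e _; rewrite subr_ge0; have /andP[] := hq e.1 e.2.
  apply: graph_mean_le => // G _; apply: ler_prod => j dij; rewrite subr_ge0.
  have /andP[_ ->] /= := xa01 j G.
  have -> : absent R (D j) (G :\: D i) = absent R (D j) G; last by [].
  congr (_%:R); congr nat_of_bool; rewrite -!setI_eq0; congr (_ == _).
  apply/setP => e; rewrite !inE; case: (boolP (e \in D j)) => //= ej.
  by have := disjointFl dij ej => ->.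
rewrite mulr_sumr; apply: ler_sum => j _.
rewrite mulrCA ler_wpM2l //; first by have /andP[] := hx j.
have sU : D i :|: D j \subset vpairs n by rewrite subUset !sD.
rewrite graph_mean_absent // mulrC; apply: ler_wpM2r.
  by apply: prodr_ge0 => e _; rewrite subr_ge0; have /andP[] := hq e.1 e.2.
apply: graph_mean_le => // G _; apply: ler_prod => l _; rewrite subr_ge0.
have /andP[_ ->] /= := xa01 l (G :\: (D i :|: D j)).
rewrite lerB // ler_wpM2l //; first by have /andP[] := hx l.
rewrite ler_nat; case: (boolP [disjoint D l & G]) => // dG.
suff -> : [disjoint D l & G :\: (D i :|: D j)] by [].
by apply: disjointWr dG; exact: subsetDl.
Qed.

(* Janson's inequality, with the Laplace weight of each event free in [0, 1]. *)
Lemma janson (R : realType) (n : nat) (q : 'I_n -> 'I_n -> R)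
    (J : finType) (D : J -> {set 'I_n * 'I_n}) (x : J -> R) :
  edge_law q -> (forall j, D j \subset vpairs n) -> (forall j, 0 <= x j <= 1) ->
  graph_prob q (fun G => [forall j, (x j != 0) ==> ~~ [disjoint D j & G]]) <=
  expR (\sum_i \sum_(j | ~~ [disjoint D i & D j])
           x i * x j * \prod_(e in D i :|: D j) (1 - q e.1 e.2)
        - \sum_j x j * \prod_(e in D j) (1 - q e.1 e.2)).
Proof.
move=> hq sD hx.
have xa01 j G : 0 <= x j * absent R (D j) G <= 1.
  have /andP[x0 x1] := hx j; rewrite mulr_ge0 ?absent_ge0 //=.
  by rewrite -[leRHS]mulr1 ler_pM // ?absent_ge0 // absent_le1.
have P0 (E : {set 'I_n * 'I_n}) : 0 <= \prod_(e in E) (1 - q e.1 e.2).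
  by apply: prodr_ge0 => e _; rewrite subr_ge0; have /andP[] := hq e.1 e.2.
(* If every event of nonzero weight fails, all factors of [Z] are 1, so the expectation of [Z]
   bounds the probability; the events enter it one at a time. *)
pose Z r G := \prod_(j <- r) (1 - x j * absent R (D j) G).
pose ex i r := \sum_(j <- r | ~~ [disjoint D i & D j])
           x i * x j * \prod_(e in D i :|: D j) (1 - q e.1 e.2).
have Z0 r G : 0 <= Z r G.
  by apply: prodr_ge0 => j _; rewrite subr_ge0; have /andP[] := xa01 j G.
have ex0 i r : 0 <= ex i r.
  apply: sumr_ge0 => j _; rewrite !mulr_ge0 //.
    by have /andP[] := hx i.
  by have /andP[] := hx j.
apply: (@le_trans _ _ (graph_mean q (Z (index_enum J)))).
  rewrite graph_probE; apply: graph_mean_le => // G _.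
  case: (boolP [forall j, _]) => [/forallP h|_]; last exact: Z0.
  rewrite /Z big1 // => j _; have := h j; rewrite /absent.
  case: (eqVneq (x j) 0) => [->|_ /negbTE ->]; first by rewrite mul0r subr0.
  by rewrite mulr0 subr0.
apply: (@le_trans _ _ (expR (\sum_i ex i (index_enum J)
        - \sum_j x j * \prod_(e in D j) (1 - q e.1 e.2)))); last by [].
have key r : subseq r (index_enum J) -> graph_mean q (Z r) <=
    expR (\sum_(i <- r) ex i (index_enum J)
        - \sum_(j <- r) x j * \prod_(e in D j) (1 - q e.1 e.2)).
  elim: r => [_|i r IH sr].
    rewrite !big_nil subr0 expR0 -[leRHS](graph_mean1 q); apply: graph_mean_le => // G _.
    by rewrite /Z big_nil.
  have {}IH := IH (subseq_trans (subseq_cons _ _) sr).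
  have /andP[xi0 xi1] := hx i.
  set a := x i * \prod_(e in D i) (1 - q e.1 e.2).
  have aex : graph_mean q (Z (i :: r)) <= graph_mean q (Z r) * expR (ex i r - a).
    (* If the correction outweighs [a], the exponential is at least 1 and the new factor is simply
       dropped. The other case replaces [Z r] by the larger [C] in a product with [a - ex i r],
       which needs its sign. *)
    have [neg|pos] := leP (a - ex i r) 0.
      apply: (@le_trans _ _ (graph_mean q (Z r))).
        apply: graph_mean_le => // G _; rewrite /Z big_cons -[leRHS]mul1r ler_wpM2r //; first exact: Z0.
        by rewrite gerBl; have /andP[] := xa01 i G.
      rewrite -[leLHS]mulr1 ler_wpM2l //.
        by apply: sumr_ge0 => G _; rewrite mulr_ge0 // graph_mass_ge0.
      by rewrite -expR0 ler_expR -subr_le0 sub0r opprB.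
    have step := janson_step i r hq sD hx.
    set C := (fun G => \prod_(j <- r | [disjoint D i & D j]) (1 - x j * absent R (D j) G)) in step.
    have ZC : graph_mean q (Z r) <= graph_mean q C.
      apply: graph_mean_le => // G _; rewrite /Z (bigID (fun j => [disjoint D i & D j])) /=.
      rewrite -[leRHS]mulr1 ler_wpM2l //.
        by apply: prodr_ge0 => j _; rewrite subr_ge0; have /andP[] := xa01 j G.
      apply: prodr_ile1 => j _; rewrite subr_ge0 gerBl.
      by have /andP[-> ->] := xa01 j G.
    have -> : graph_mean q (Z (i :: r)) = graph_mean q (Z r) - x i * graph_mean q (fun G => absent R (D i) G * Z r G).
      rewrite -graph_mean_scale -graph_mean_sub; apply: eq_graph_mean => G _.
      by rewrite /Z big_cons mulrBl mul1r mulrA.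
    apply: (@le_trans _ _ (graph_mean q (Z r) * (1 + (ex i r - a)))); last first.
      by rewrite ler_wpM2l ?expR_ge1Dx // sumr_ge0 // => G _; rewrite mulr_ge0 // graph_mass_ge0.
    rewrite mulrDr mulr1 lerD2l -opprB mulrN lerN2.
    apply: le_trans (ler_wpM2l xi0 step).
    rewrite [leRHS](_ : _ = graph_mean q C * (a - ex i r)).
      by apply: ler_wpM2r => //; exact: ltW.
    rewrite mulrCA mulrBr -/a mulr_sumr; congr (_ * (_ - _)).
    by apply: eq_bigr => j _; rewrite mulrA.
  apply: (le_trans aex).
  apply: (le_trans (ler_wpM2r (expR_ge0 _) IH)).
  rewrite -expRD ler_expR !big_cons -/a opprD.
  rewrite [X in _ <= X](_ : _ = (\sum_(i0 <- r) ex i0 (index_enum J) - \sum_(j <- r) x j * \prod_(e in D j) (1 - q e.1 e.2)) + (ex i (index_enum J) - a)); last first.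
    by rewrite addrACA addrC.
  rewrite lerD2l lerD2r /ex; have sr' := subseq_trans (subseq_cons _ _) sr.
  have pz j : 0 <= x i * x j * \prod_(e in D i :|: D j) (1 - q e.1 e.2).
    by rewrite !mulr_ge0 //; have /andP[] := hx j.
  have [mm _ ->] := subseqP sr'.
  elim: (index_enum J) mm {sr sr' IH aex} => [|j t IHt] [|b mm] //=.
  - by rewrite big_nil sumr_ge0.
  - rewrite big_cons; case: b; rewrite ?big_cons; case: ifP => _ //.
    + by rewrite lerD2l.
    + by apply: (le_trans (IHt mm)); rewrite lerDr.
exact: key.
Qed.

(** Rankin's trick: a set of size at least j gets the extra weight e^(b (|I| - j)) >= 1, after which
    the binomial theorem sums over all sets. It serves the union bounds and the overlap sum below,
    with b tuned each time. *)
Lemma sum_large_sets (R : realType) (T : finType) (z b j : R) :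
  0 <= z -> 0 <= b ->
  \sum_(I : {set T} | j <= #|I|%:R) z ^+ #|I| <= expR (expR b * z * #|T|%:R - b * j).
Proof.
move=> z0 b0.
apply: (@le_trans _ _ (\sum_(I : {set T}) expR (- (b * j)) * (expR b * z) ^+ #|I|)).
  rewrite big_mkcond; apply: ler_sum => I _; case: ifP => [jI|_]; last first.
    by rewrite mulr_ge0 ?expR_ge0 // exprn_ge0 // mulr_ge0 ?expR_ge0.
  rewrite exprMn mulrA -[leLHS]mul1r ler_wpM2r ?exprn_ge0 //.
  rewrite -expRM_natr -expRD -[leLHS]expR0 ler_expR addrC subr_ge0 ler_wpM2l //.
rewrite -mulr_sumr addrC expRD ler_wpM2l ?expR_ge0 //.
have -> : \sum_(I : {set T}) (expR b * z) ^+ #|I| = (expR b * z + 1) ^+ #|T|.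
  rewrite -[RHS](prodr_const (pred_of_simpl predT)) bigA_distr; apply: eq_bigr => I _.
  rewrite [RHS](bigID (fun i => i \in I)) /= [X in _ = _ * X]big1 ?mulr1; last first.
    by move=> i /negbTE ->.
  by rewrite -prodr_const; apply: eq_bigr => i ->.
rewrite expRM_natr lerXn2r ?nnegrE ?addr_ge0 ?mulr_ge0 ?expR_ge0 //.
by rewrite addrC expR_ge1Dx.
Qed.

(** * Colourings *)

Definition inner (n : nat) (S : {set 'I_n}) : {set 'I_n * 'I_n} :=
  [set e in vpairs n | (e.1 \in S) && (e.2 \in S)].

Lemma inner_sub (n : nat) (S : {set 'I_n}) : inner S \subset vpairs n.
Proof. by apply/subsetP => e; rewrite inE => /andP[]. Qed.

Lemma innerI (n : nat) (S T : {set 'I_n}) : inner S :&: inner T = inner (S :&: T).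
Proof.
apply/setP => e; rewrite !inE; case: (_ < _)%N => //=.
by case: (e.1 \in S); case: (e.2 \in S); case: (e.1 \in T); case: (e.2 \in T).
Qed.

Lemma sum_inner (R : numDomainType) (n : nat) (F : 'I_n -> 'I_n -> R) (S : {set 'I_n}) :
  (forall i j, F i j = F j i) ->
  (\sum_(e in inner S) F e.1 e.2) *+ 2 = \sum_(i in S) \sum_(j in S | j != i) F i j.
Proof.
move=> symF; rewrite pair_big_dep /= [RHS](bigID (fun e : 'I_n * 'I_n => (e.1 < e.2)%N)) /=.
rewrite mulr2n; congr (_ + _).
  apply: eq_bigl => e; rewrite !inE andbC; case: (ltnP e.1 e.2) => [lt|]; last by rewrite !andbF.
  by rewrite !andbT neq_ltn lt orbT andbT.
rewrite (reindex_inj (h := fun e : 'I_n * 'I_n => (e.2, e.1))) /=; last first.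
  by move=> [a b] [c d] /= [-> ->].
apply: eq_big => [e|e _]; last exact: symF.
rewrite !inE -leqNgt; case: (ltnP e.2 e.1) => [lt|le] /=.
  by rewrite neq_ltn lt (ltnW lt) andbT /= andbT andbC.
case: eqP => //=; rewrite ?andbF // => /eqP ne.
by rewrite leqNgt ltn_neqAle le eq_sym ne /= andbF.
Qed.

Lemma indep_adj (n : nat) (G : {set 'I_n * 'I_n}) (S : {set 'I_n}) :
  G \subset vpairs n -> [disjoint inner S & G] = [forall i in S, forall j in S, ~~ adj G i j].
Proof.
move=> sG; apply/idP/idP => [dG|h].
  apply/'forall_implyP => i iS; apply/'forall_implyP => j jS; apply/negP.
  by case/orP=> eG; have := disjointFl dG eG; rewrite inE (subsetP sG) //= iS jS.
rewrite disjoint_subset; apply/subsetP => -[i j]; rewrite !inE /= => /and3P[_ iS jS].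
have /'forall_implyP/(_ i iS)/'forall_implyP/(_ j jS) := h.
by rewrite negb_or => /andP[].
Qed.

(** Colours are natural numbers and [c] is total, so that palettes can be shifted and colourings of
    different vertex sets glued. *)
Definition colored (n : nat) (G : {set 'I_n * 'I_n}) (X : {set 'I_n}) (k : nat) : Prop :=
  exists2 c : 'I_n -> nat, {in X, forall x, c x < k}%N &
    {in X &, forall x y, adj G x y -> c x <> c y}.

Lemma colored_chi (n : nat) (G : {set 'I_n * 'I_n}) (k : nat) :
  G \subset vpairs n -> colored G [set: 'I_n] k -> (chi G <= k)%N.
Proof.
move=> sG [c ck cG]; have [_ ] := chromatic_numberP (adj_irr sG); apply.
have ck' x : (c x < k)%N by apply: ck; rewrite inE.
apply/existsP; exists [ffun x => Ordinal (ck' x)].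
apply/forallP => x; apply/forallP => y; apply/implyP => xy; rewrite !ffunE.
by apply/eqP => /(congr1 val) /=; apply: cG; rewrite ?inE.
Qed.

Lemma coloredU (n : nat) (G : {set 'I_n * 'I_n}) (X Y : {set 'I_n}) (j k : nat) :
  colored G X j -> colored G Y k -> colored G (X :|: Y) (j + k).
Proof.
move=> [c cj cG] [d dk dG].
exists (fun x => if x \in X then c x else (j + d x)%N).
  move=> x; rewrite inE; case: ifP => [xX _|_ /= xY]; last by rewrite ltn_add2l dk.
  by apply: leq_trans (cj x xX) _; exact: leq_addr.
move=> x y; rewrite !inE; case: ifP => [xX _|_ /= xY]; case: ifP => [yX _|_ /= yY] xy.
- exact: cG.
- by move=> e; have := cj x xX; rewrite e ltnNge leq_addr.
- by move=> e; have := cj y yX; rewrite -e ltnNge leq_addr.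
- by move/addnI; apply: dG.
Qed.

Lemma coloredS (n : nat) (G : {set 'I_n * 'I_n}) (X Y : {set 'I_n}) (j k : nat) :
  (j <= k)%N -> X \subset Y -> colored G Y j -> colored G X k.
Proof.
move=> jk /subsetP XY [c cj cG]; exists c.
  by move=> x /XY xY; apply: leq_trans jk; exact: cj.
by move=> x y /XY xY /XY yY; exact: cG.
Qed.

Lemma colored0 (n : nat) (G : {set 'I_n * 'I_n}) k : colored G set0 k.
Proof. by exists (fun=> 0%N) => x; rewrite ?inE // => y; rewrite inE. Qed.

Lemma indep_colored (n : nat) (G : {set 'I_n * 'I_n}) (S : {set 'I_n}) :
  G \subset vpairs n -> [disjoint inner S & G] -> colored G S 1.
Proof.
move=> sG; rewrite indep_adj // => /'forall_implyP h; exists (fun=> 0%N) => // x y xS yS xy.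
by have /'forall_implyP/(_ y yS) := h x xS; rewrite xy.
Qed.

Lemma adj_sym (n : nat) (G : {set 'I_n * 'I_n}) i j : adj G i j = adj G j i.
Proof. by rewrite /adj orbC. Qed.

(** Greedy colouring: a vertex with fewer than [d] neighbours is coloured last, with a colour
    missing from its neighbourhood. *)
Lemma degenerate_colored (n : nat) (G : {set 'I_n * 'I_n}) (X : {set 'I_n}) (d : nat) :
  G \subset vpairs n ->
  (forall Y : {set 'I_n}, Y \subset X -> Y != set0 ->
     exists2 x, x \in Y & (#|[set y in Y | adj G x y]| < d)%N) ->
  colored G X d.
Proof.
move=> sG; have [m] := ubnP #|X|; elim: m => // m IH in X *; rewrite ltnS => Xm h.
have [->|Xn0] := eqVneq X set0; first exact: colored0.
have [x xX degx] := h X (subxx _) Xn0.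
have [||c cd cG] := IH (X :\ x).
- by apply: leq_trans Xm; rewrite [X in (_ < X)%N](cardsD1 x) xX.
- by move=> Y sY; apply: h; exact: subset_trans sY (subD1set _ _).
pose N := [set y in X | adj G x y].
have [a ad aN] : exists2 a, (a < d)%N & {in N, forall y, c y <> a}.
  have [/existsP[a]|a] := boolP [exists a : 'I_d, [forall y in N, c y != a]].
    by move=> /'forall_implyP ha; exists a => // y /ha /eqP.
  (* If each of the [d] colours occurred in [N], one vertex per colour would give [d] neighbours. *)
  exfalso; move: a; rewrite negb_exists => /forallP ha.
  have /fin_all_exists[g gP] : forall a : 'I_d, exists y, y \in N /\ c y = a :> nat.
    move=> a; have := ha a; rewrite negb_forall => /existsP[y].
    by rewrite negb_imply negbK => /andP[yN /eqP]; exists y.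
  have gN a : g a \in N by case: (gP a).
  have cg a : c (g a) = a :> nat by case: (gP a).
  have ginj : injective g by move=> a b /(congr1 c); rewrite !cg => /val_inj.
  suff : (d <= #|N|)%N by rewrite leqNgt degx.
  rewrite -[d]card_ord -(card_imset predT ginj); apply: subset_leq_card.
  by apply/subsetP => _ /imsetP[a _ ->].
exists (fun y => if y == x then a else c y).
  by move=> y yX; case: eqP => // /eqP yx; apply: cd; rewrite !inE yx.
move=> y z yX zX; have irr := adj_irr sG.
case: eqP => [->|/eqP yx]; case: eqP => [->|/eqP zx] yz.
- by rewrite irr in yz.
- by move/esym; apply: aN; rewrite inE zX yz.
- by apply: aN; rewrite inE yX adj_sym yz.
- by apply: cG; rewrite // !inE ?yx ?zx.
Qed.

(** * Sparse subgraphs *)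

Lemma expR1_le4 (R : realType) : expR 1 <= 4 :> R.
Proof.
have h : 2^-1 <= expR (- 2^-1) :> R by apply: le_trans (expR_ge1Dx _); lra.
have -> : expR 1 = (expR (- 2^-1) ^+ 2)^-1 :> R.
  by rewrite -expRM_natr -expRN; congr expR; lra.
have h2 : (2^-1) ^+ 2 <= expR (- 2^-1) ^+ 2 :> R by rewrite lerXn2r ?nnegrE ?expR_ge0 // invr_ge0.
rewrite -[leRHS]invrK lef_pV2 ?posrE ?invr_gt0 ?exprn_gt0 ?expR_gt0 //.
by apply: le_trans h2; lra.
Qed.

Lemma graph_prob_le (R : numDomainType) (n : nat) (q : 'I_n -> 'I_n -> R)
    (A B : pred {set 'I_n * 'I_n}) : edge_law q ->
  (forall G : {set 'I_n * 'I_n}, G \subset vpairs n -> A G -> B G) ->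
  graph_prob q A <= graph_prob q B.
Proof.
move=> hq AB; rewrite !graph_probE; apply: graph_mean_le => // G sG.
by have := AB G sG; case: (A G) => [->//|_]; rewrite ler0n.
Qed.

Lemma graph_probU (R : numDomainType) (n : nat) (q : 'I_n -> 'I_n -> R)
    (J : finType) (P : pred J) (A : J -> pred {set 'I_n * 'I_n}) : edge_law q ->
  graph_prob q (fun G => [exists j, P j && A j G]) <= \sum_(j | P j) graph_prob q (A j).
Proof.
move=> hq; under [leRHS]eq_bigr => j _ do rewrite graph_probE.
rewrite -graph_mean_sum graph_probE; apply: graph_mean_le => // G _.
case: existsP => [[j /andP[Pj Aj]]|_]; last by apply: sumr_ge0 => j _; exact: ler0n.
by rewrite (bigD1 j) //= Aj lerDl; apply: sumr_ge0 => l _; exact: ler0n.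
Qed.

Lemma inner_const (R : numDomainType) (n : nat) (X : {set 'I_n}) (a : R) : 0 <= a ->
  (\sum_(e in inner X) a) *+ 2 <= a * #|X|%:R ^+ 2.
Proof.
move=> a0; rewrite (sum_inner (F := fun _ _ => a)) //.
apply: (@le_trans _ _ (\sum_(i in X) \sum_(j in X) a)).
  apply: ler_sum => i _; rewrite big_mkcondr; apply: ler_sum => j _.
  by case: ifP.
by rewrite !sumr_const -mulrnA -[leLHS]mulr_natr natrM expr2.
Qed.

(** This makes any [m] leftover vertices greedily colourable with [d] colours. Minimum degree [d] on
    X forces |X| d / 2 >= 4 p m |X| edges, whereas the expectation of e to the number of edges in X
    is at most e^(3 p m |X|). *)
Lemma sparse_prob (R : realType) (n : nat) (q : 'I_n -> 'I_n -> R) (p : R) (m d : nat) :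
  edge_law q -> (forall i j, q i j <= 2 * p) -> 0 <= p ->
  8 * p * m%:R <= d%:R -> n%:R * expR (- (p * m%:R / 2)) <= 1 ->
  graph_prob q (fun G => [exists X : {set 'I_n}, (1 <= #|X| <= m)%N &&
      [forall x in X, (d <= #|[set y in X | adj G x y]|)%N]])
  <= expR (1 - p * m%:R / 2).
Proof.
move=> hq qp p0 md hn; apply: le_trans (graph_probU _ _ hq) _.
set z := expR (- (p * m%:R)).
apply: (@le_trans _ _ (\sum_(X : {set 'I_n} | 1 <= #|X|%:R :> R) z ^+ #|X|)); last first.
  (* Half of the decay of [z] is spent on the factor n; the other half is the bound that remains. *)
  apply: le_trans (sum_large_sets _ _ (b := p * m%:R / 2) _ _) _.
  - exact: expR_ge0.
  - by rewrite divr_ge0 ?mulr_ge0.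
  rewrite ler_expR mulr1 lerD2r card_ord -expRD mulrC.
  by apply: le_trans hn; rewrite le_eqVlt; apply/orP; left; apply/eqP; congr (_ * expR _); lra.
rewrite [leLHS]big_mkcond [leRHS]big_mkcond; apply: ler_sum => X _.
rewrite (ler_nat R 1); case: ifP => [/andP[X1 Xm]|_]; last by case: ifP => // _; exact: exprn_ge0 (expR_ge0 _).
rewrite X1.
apply: (@le_trans _ _ (graph_mean q (fun G => expR (- (#|X|%:R * d%:R / 2)) * \prod_(e in inner X :&: G) expR 1))).
  rewrite graph_probE; apply: graph_mean_le => // G sG; case: (boolP [forall x in X, _]) => [/'forall_implyP hX|_]; last first.
    by rewrite mulr_ge0 ?expR_ge0 // prodr_ge0 // => e _; exact: expR_ge0.
  rewrite prodr_const -expRM_natr mul1r -expRD -[leLHS]expR0 ler_expR addrC subr_ge0.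
  rewrite ler_pdivrMr // -natrM -[2]/(2%:R) -natrM ler_nat.
  have -> : (#|inner X :&: G| * 2 = \sum_(x in X) #|[set y in X | adj G x y]|)%N.
    apply/eqP; rewrite -(eqr_nat int) natrM natr_sum; apply/eqP.
    have := sum_inner (F := fun i j => (adj G i j)%:R : int) X (fun i j => congr1 (fun b : bool => b%:R) (adj_sym G i j)).
    move=> e1; rewrite -[LHS]mulr_natr in e1; transitivity ((\sum_(e in inner X) (adj G e.1 e.2)%:R) * 2 : int).
      congr (_ * _); rewrite -[LHS]sumr_const [RHS]big_mkcond [LHS]big_mkcond; apply: eq_bigr => -[i j] _.
      rewrite in_setI /=; case: (boolP ((i, j) \in inner X)) => //=; rewrite inE /= => /andP[ij _].
      rewrite /adj; case: (boolP ((i, j) \in G)) => //= _.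
      case: (boolP ((j, i) \in G)) => //= /(subsetP sG); rewrite !inE /= in ij *.
      by rewrite ltnNge (ltnW ij).
    rewrite e1; apply: eq_bigr => i _; rewrite -[RHS]sumr_const big_mkcondr [RHS]big_mkcond.
    rewrite [LHS]big_mkcond; apply: eq_bigr => j _; rewrite inE; case: (j \in X) => //=.
    by case: eqP => [->|_] /=; rewrite ?(adj_irr sG) //; case: (adj G i j).
  by rewrite -sum_nat_const; apply: leq_sum => x xX; exact: hX.
rewrite graph_mean_scale graph_mean_prod ?inner_sub //.
have -> : z ^+ #|X| = expR (- (#|X|%:R * d%:R / 2)) * expR (#|X|%:R * d%:R / 2 - p * m%:R * #|X|%:R).
  by rewrite -expRM_natr -expRD; congr expR; ring.
rewrite ler_wpM2l ?expR_ge0 //.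
(* By e <= 4 and q <= 2 p, each factor 1 - q + e q is at most 1 + 3 q <= 1 + 6 p. *)
apply: (@le_trans _ _ (\prod_(e in inner X) expR (6 * p))).
  apply: ler_prod => e _; have /andP[q0 q1] := hq e.1 e.2; have q2 := qp e.1 e.2.
  apply/andP; split.
    by rewrite addr_ge0 ?subr_ge0 // mulr_ge0 // expR_ge0.
  apply: le_trans (expR_ge1Dx _); have := expR1_le4 R => e4.
  have : expR 1 * q e.1 e.2 <= 4 * q e.1 e.2 by rewrite ler_wpM2r.
  lra.
rewrite -expR_sum ler_expR.
have c6 : 0 <= 6 * p by rewrite mulr_ge0.
have := inner_const X c6; rewrite -mulr_natr => h.
have xm : #|X|%:R <= m%:R :> R by rewrite ler_nat.
have x0 : 0 <= #|X|%:R :> R by [].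
have h1 : p * #|X|%:R * #|X|%:R <= p * #|X|%:R * m%:R by rewrite ler_wpM2l // mulr_ge0.
have h2 : #|X|%:R * (8 * p * m%:R) <= #|X|%:R * d%:R by rewrite ler_wpM2l.
rewrite expr2 in h; move: h h1 h2; set S := \sum_(e in _) _; set x := #|X|%:R; set M := m%:R; set dd := d%:R.
lra.
Qed.

(** * Independent transversals *)

Lemma card_family_prod (R : comNzSemiRingType) (I T : finType) (Q : I -> {pred T}) :
  #|family Q|%:R = \prod_i #|Q i|%:R :> R.
Proof.
under [RHS]eq_bigr => i _ do rewrite -sumr_const.
by rewrite bigA_distr_big_dep -sumr_const; apply: eq_bigr => f _; rewrite big1.
Qed.

Lemma prod_setUI (R : comNzSemiRingType) (T : finType) (A B : {set T}) (F : T -> R) :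
  (\prod_(e in A :|: B) F e) * \prod_(e in A :&: B) F e =
  (\prod_(e in A) F e) * \prod_(e in B) F e.
Proof.
rewrite big_mkcond [X in _ * X]big_mkcond [X in _ = X * _]big_mkcond [X in _ = _ * X]big_mkcond.
rewrite -!big_split /=; apply: eq_bigr => e _; rewrite !inE.
by case: (e \in A); case: (e \in B); rewrite ?mulr1 ?mul1r.
Qed.

(** The index is a [nat] because, when k does not divide n, the vertices beyond the last full block
    have an index outside ['I_s]. *)
Definition block (n : nat) (blk : 'I_n -> nat) (V : {set 'I_n}) (t : nat) : {set 'I_n} :=
  [set i in V | blk i == t].

(** Functions rather than vertex sets, so that their number is the product of the block sizes. *)
Definition transversals (n s : nat) (blk : 'I_n -> nat) (V : {set 'I_n}) :=
  family (fun t : 'I_s => pred_of_set (block blk V t)).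

(** The sum of [phi] over unordered pairs of blocks of [I]. Its negative exponential will bound from
    below the probability that one vertex from each block of [I] gives an independent set. *)
Definition pair_energy (R : unitRingType) (s : nat) (phi : nat -> nat -> R) (I : {set 'I_s}) : R :=
  (\sum_(t in I) \sum_(t' in I | t' != t) phi t t') / 2.

Lemma transversal_blk (n s : nat) (blk : 'I_n -> nat) (V : {set 'I_n}) (f : {ffun 'I_s -> 'I_n}) :
  f \in transversals s blk V -> forall t, blk (f t) = t /\ f t \in V.
Proof. by move=> /familyP h t; have := h t; rewrite !inE => /andP[? /eqP]. Qed.

Lemma blk_inj (n s : nat) (blk : 'I_n -> nat) (f : {ffun 'I_s -> 'I_n}) :
  (forall t, blk (f t) = t) -> injective f.
Proof. by move=> h a b /(congr1 blk); rewrite !h => /val_inj. Qed.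

Lemma prob_indep_ge (R : realType) (n s : nat) (q : 'I_n -> 'I_n -> R)
    (blk : 'I_n -> nat) (phi : nat -> nat -> R) (f : {ffun 'I_s -> 'I_n}) (I : {set 'I_s}) :
  (forall i j, phi i j = phi j i) ->
  (forall i j, expR (- phi (blk i) (blk j)) <= 1 - q i j) ->
  (forall t, blk (f t) = t) ->
  expR (- pair_energy phi I) <= \prod_(e in inner (f @: I)) (1 - q e.1 e.2).
Proof.
move=> symphi hq hf.
apply: (@le_trans _ _ (\prod_(e in inner (f @: I)) expR (- phi (blk e.1) (blk e.2)))); last first.
  by apply: ler_prod => e _; rewrite expR_ge0 hq.
rewrite -expR_sum ler_expR sumrN lerN2.
have finj := blk_inj hf.
have := sum_inner (F := fun i j => phi (blk i) (blk j)) (f @: I) (fun i j => symphi _ _).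
rewrite big_imset /=; last by move=> a b _ _; exact: finj.
rewrite /pair_energy.
rewrite (eq_bigr (fun t => \sum_(t' in I | t' != t) phi t t')) => [<-|t tI].
  by set S := (\sum_(_ in inner _) _); lra.
rewrite (eq_bigl (fun j => (j \in f @: I) && (j \in [set x | x != f t]))); last by move=> j; rewrite inE.
rewrite big_mkcondr big_imset /=; last by move=> a b _ _; exact: finj.
rewrite -big_mkcondr; apply: eq_big => [t'|t' _]; last by rewrite !hf.
by rewrite inE (inj_eq finj).
Qed.

(** The weights [lam / P f] give all transversals the same mass in Janson's inequality. If f and g
    agree exactly on A, both are independent with probability P f P g / P(f(A)), so after weighting
    the pair term depends on A alone and is at most lam^2 times the exponential of the energy of
    A. *)
Lemma transversal_prob (R : realType) (n s M : nat) (q : 'I_n -> 'I_n -> R)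
    (blk : 'I_n -> nat) (phi : nat -> nat -> R) (rho : R) (V : {set 'I_n}) :
  edge_law q -> (forall i j, phi i j = phi j i) ->
  (forall i j, expR (- phi (blk i) (blk j)) <= 1 - q i j) ->
  (1 < s)%N -> (0 < M)%N -> (forall t : 'I_s, M <= #|block blk V t|)%N ->
  \sum_(I : {set 'I_s} | (1 < #|I|)%N) expR (pair_energy phi I) * M%:R^-1 ^+ #|I| <= rho ->
  graph_prob q (fun G => [forall f, (f \in transversals s blk V) ==>
      ~~ [disjoint inner (f @: [set: 'I_s]) & G]])
  <= expR (- (4 * rho)^-1).
Proof.
move=> hq symphi hphi s1 M0 hV hrho.
set Fam := transversals s blk V.
have M0R : 0 < M%:R :> R by rewrite ltr0n.
pose N : R := #|Fam|%:R.
have NE : N = \prod_(t < s) #|block blk V t|%:R by exact: card_family_prod.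
have NM : M%:R ^+ s <= N.
  rewrite NE -[s in _ ^+ s]card_ord -prodr_const; apply: ler_prod => t _.
  by rewrite ler0n ler_nat hV.
have N0 : 0 < N by apply: lt_le_trans NM; exact: exprn_gt0.
pose P (f : {ffun 'I_s -> 'I_n}) := \prod_(e in inner (f @: [set: 'I_s])) (1 - q e.1 e.2).
have q1 (e : 'I_n * 'I_n) : 0 < 1 - q e.1 e.2.
  by apply: lt_le_trans (hphi e.1 e.2); exact: expR_gt0.
have P0 f : 0 < P f by apply: prodr_gt0 => e _; exact: q1.
(* The full set is a term of the overlap sum; its bound by [rho] keeps the weights [lam / P f] at
   most 1. *)
have top : expR (pair_energy phi [set: 'I_s]) / M%:R ^+ s <= rho.
  apply: le_trans hrho; rewrite (bigD1 [set: 'I_s]) /=; last by rewrite cardsT card_ord.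
  rewrite cardsT card_ord exprVn lerDl; apply: sumr_ge0 => I _.
  by rewrite mulr_ge0 ?expR_ge0 // exprn_ge0 // invr_ge0.
have rho0 : 0 < rho by apply: lt_le_trans top; rewrite divr_gt0 ?expR_gt0 ?exprn_gt0.
(* This minimises rho (lam N)^2 - lam N, the exponent left by Janson's inequality. *)
pose lam := (2 * rho * N)^-1.
have lam0 : 0 < lam by rewrite invr_gt0 !mulr_gt0.
have lamP f : f \in Fam -> lam <= P f.
  move=> fF; have hf t : blk (f t) = t by have [] := transversal_blk fF t.
  apply: le_trans (prob_indep_ge setT symphi hphi hf).
  rewrite expRN lef_pV2 ?posrE ?expR_gt0 ?mulr_gt0 //.
  apply: (@le_trans _ _ (rho * N)); last by rewrite -mulrA; have := mulr_gt0 rho0 N0; lra.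
  rewrite ler_pdivrMr ?exprn_gt0 // in top; apply: (le_trans top).
  by rewrite ler_wpM2l // ltW.
pose x f := if f \in Fam then lam / P f else 0.
have hx f : 0 <= x f <= 1.
  rewrite /x; case: ifP => [fF|_]; last by rewrite lexx ler01.
  by rewrite (divr_ge0 (ltW lam0) (ltW (P0 f))) /= ler_pdivrMr // mul1r lamP.
have := janson (D := fun f : {ffun 'I_s -> 'I_n} => inner (f @: [set: 'I_s])) hq
  (fun f => inner_sub _) hx.
move=> J; apply: le_trans (le_trans _ J) _.
  apply: graph_prob_le => // G sG /forallP h; apply/forallP => f.
  apply/implyP; rewrite /x; case: ifP => [fF _|_]; last by rewrite eqxx.
  by have := h f; rewrite fF.
rewrite ler_expR.
have -> : \sum_j x j * \prod_(e in inner [set j x0 | x0 in [set: 'I_s]]) (1 - q e.1 e.2) = lam * N.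
  rewrite [RHS]mulr_natr -sumr_const [RHS]big_mkcond; apply: eq_bigr => f _.
  by rewrite /x; case: ifP => _; rewrite ?mul0r // -/(P f) divfK // gt_eqF.
have D : \sum_(i : {ffun 'I_s -> 'I_n}) \sum_(j : {ffun 'I_s -> 'I_n} | ~~ [disjoint inner (i @: [set: 'I_s]) & inner (j @: [set: 'I_s])])
     x i * x j * \prod_(e in inner (i @: [set: 'I_s]) :|: inner (j @: [set: 'I_s])) (1 - q e.1 e.2)
   <= lam ^+ 2 * (N * (N * rho)).
  (* The exact agreement set is relaxed to a sum over all its subsets [I], because the g that agree
     with f on a given [I] are counted by a product. *)
  apply: (@le_trans _ _ (\sum_(f in Fam) \sum_(g in Fam) \sum_(I : {set 'I_s} | (1 < #|I|)%N)
      lam ^+ 2 * (expR (pair_energy phi I) * (I \subset [set t | f t == g t])%:R))).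
    rewrite [leRHS]big_mkcond; apply: ler_sum => f _; case: ifP => [fF|fF]; last first.
      by rewrite big1 // => g _; rewrite /x fF !mul0r.
    rewrite [leRHS]big_mkcond [leLHS]big_mkcond; apply: ler_sum => g _.
    have S0 : 0 <= \sum_(I : {set 'I_s} | (1 < #|I|)%N)
       lam ^+ 2 * (expR (pair_energy phi I) * (I \subset [set t | f t == g t])%:R).
      by apply: sumr_ge0 => I _; rewrite !mulr_ge0 ?expR_ge0 ?(ltW lam0).
    case: (boolP (g \in Fam)) => [gF|/negbTE gF]; last first.
      by case: ifP => // _; rewrite /x gF mulr0 mul0r.
    case: ifP => // nd.
    have hf t : blk (f t) = t by have [] := transversal_blk fF t.
    have hg t : blk (g t) = t by have [] := transversal_blk gF t.
    set A := [set t | f t == g t].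
    have AE : f @: [set: 'I_s] :&: g @: [set: 'I_s] = f @: A.
      apply/setP => v; rewrite inE; apply/andP/imsetP => [[/imsetP[t _ ->] /imsetP[t' _ e]]|[t]].
        have : t = t' by apply/val_inj; rewrite /= -hf -hg e.
        by move=> tt'; exists t => //; rewrite inE e tt'.
      rewrite inE => /eqP fg ->; split; apply/imsetP; exists t => //.
    (* A common pair needs two common vertices, hence agreement in at least two blocks. *)
    have A2 : (1 < #|A|)%N.
      move: nd; rewrite -setI_eq0 innerI AE => /set0Pn[e]; rewrite !inE => /and3P[e12 e1 e2].
      rewrite -(card_imset _ (blk_inj hf)); apply/card_gt1P; exists e.1, e.2; split=> //.
      by rewrite neq_ltn e12.
    rewrite (bigD1 A) //= subxx mulr1.
    apply: (@le_trans _ _ (lam ^+ 2 * expR (pair_energy phi A))); last first.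
      by rewrite lerDl; apply: sumr_ge0 => I _; rewrite !mulr_ge0 ?expR_ge0 ?(ltW lam0).
    set Pfg := \prod_(e in _) _.
    have PU : Pfg * \prod_(e in inner (f @: A)) (1 - q e.1 e.2) = P f * P g.
      by rewrite -AE -innerI prod_setUI.
    have PAge := prob_indep_ge A symphi hphi hf.
    rewrite /x fF gF.
    have -> : lam / P f * (lam / P g) * Pfg = lam ^+ 2 * (Pfg / (P f * P g)).
      by rewrite invfM expr2; ring.
    rewrite ler_wpM2l ?(exprn_ge0 2 (ltW lam0)) // ler_pdivrMr ?mulr_gt0 // -PU mulrCA -[leLHS]mulr1.
    rewrite ler_wpM2l //; first by apply: prodr_ge0 => e _; exact: ltW.
    by apply: le_trans (ler_wpM2l (expR_ge0 _) PAge); rewrite expRN mulfV // gt_eqF // expR_gt0.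
  (* Agreement on [I] replaces |I| factors of the product counting transversals by 1, and each of
     them was at least [M]. *)
  have cnt f (I : {set 'I_s}) : f \in Fam -> \sum_(g in Fam) (I \subset [set t | f t == g t])%:R <= N * M%:R^-1 ^+ #|I|.
    move=> fF; pose Q (t : 'I_s) : {pred 'I_n} := pred_of_set (if t \in I then [set f t] else block blk V t).
    have -> : \sum_(g in Fam) (I \subset [set t | f t == g t])%:R = \prod_t #|Q t|%:R :> R.
      rewrite -card_family_prod -sumr_const big_mkcond [RHS]big_mkcond /=; apply: eq_bigr => g _.
      have -> : (g \in family Q) = (g \in Fam) && (I \subset [set t | f t == g t]).
        apply/familyP/andP => [h|[/familyP gF /subsetP sI] t].
          split; first (apply/familyP => t; have := h t; rewrite /Q; case: ifP => // _).
            by rewrite inE => /eqP ->; move/familyP: fF; apply.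
          apply/subsetP => t tI; have := h t; rewrite /Q tI !inE => /eqP ->.
          by rewrite eqxx.
        rewrite /Q; case: ifP => [/sI|_]; last exact: gF.
        by rewrite !inE eq_sym.
      by case: (g \in Fam) => //=; case: (_ \subset _).
    rewrite NE exprVn ler_pdivlMr ?exprn_gt0 // -prodr_const [X in _ * X]big_mkcond -big_split /=.
    apply: ler_prod => t _; rewrite /Q; case: ifP => _; rewrite ?mulr1 ?lexx ?ler0n //.
    by rewrite cards1 mul1r ler0n ler_nat hV.
  apply: (@le_trans _ _ (\sum_(f in Fam) lam ^+ 2 * (N * rho))); last first.
    by rewrite sumr_const -[leLHS]mulr_natl -/N; rewrite le_eqVlt; apply/orP; left; apply/eqP; ring.
  apply: ler_sum => f fF; rewrite exchange_big /=.
  under eq_bigr => I _ do rewrite -mulr_sumr -mulr_sumr.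
  rewrite -mulr_sumr ler_wpM2l ?(exprn_ge0 2 (ltW lam0)) //.
  apply: le_trans (ler_wpM2l (ltW N0) hrho); rewrite mulr_sumr; apply: ler_sum => I _.
  by rewrite mulrCA ler_wpM2l ?expR_ge0 // cnt.
have e1 : lam * N = (2 * rho)^-1.
  by rewrite /lam invfM -mulrA mulVf ?mulr1 // gt_eqF.
have e2 : lam ^+ 2 * (N * (N * rho)) = (4 * rho)^-1.
  transitivity ((lam * N) ^+ 2 * rho); first by ring.
  by rewrite e1; field; rewrite gt_eqF.
rewrite e1 e2 in D *; rewrite lerBlDr; apply: (le_trans D).
by rewrite le_eqVlt; apply/orP; left; apply/eqP; field; rewrite gt_eqF.
Qed.

(** * Colouring by disjoint transversals *)

Lemma graph_prob_or (R : numDomainType) (n : nat) (q : 'I_n -> 'I_n -> R)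
    (A B : pred {set 'I_n * 'I_n}) : edge_law q ->
  graph_prob q (fun G => A G || B G) <= graph_prob q A + graph_prob q B.
Proof.
move=> hq; rewrite !graph_probE /graph_mean -big_split /=; apply: ler_sum => G _.
rewrite -mulrDr ler_wpM2l ?graph_mass_ge0 // -natrD ler_nat.
by case: (A G); case: (B G).
Qed.

(** Each extracted transversal takes exactly one vertex from every block, so [M + j] vertices per
    block last for [j] rounds. *)
Lemma extract_colored (n s M : nat) (blk : 'I_n -> nat) (G : {set 'I_n * 'I_n}) :
  G \subset vpairs n ->
  (forall V : {set 'I_n}, (forall t : 'I_s, M <= #|block blk V t|)%N ->
     exists2 f, f \in transversals s blk V & [disjoint inner (f @: [set: 'I_s]) & G]) ->
  forall j (V : {set 'I_n}), (forall t : 'I_s, M + j <= #|block blk V t|)%N ->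
  exists Y : {set 'I_n}, [/\ Y \subset V, colored G Y j & #|Y| = (s * j)%N].
Proof.
move=> sG good; elim=> [|j IH] V hV.
  by exists set0; rewrite sub0set cards0 muln0; split=> //; exact: colored0.
have [|f fF dG] := good V.
  by move=> t; apply: leq_trans (hV t); exact: leq_addr.
have hf t : blk (f t) = t by have [] := transversal_blk fF t.
set S := f @: [set: 'I_s]; have [|Y [sY cY Yj]] := IH (V :\: S).
  move=> t; have -> : block blk (V :\: S) t = block blk V t :\ f t.
    apply/setP => i; rewrite !inE; case: (eqVneq i (f t)) => [->|ift] /=.
      by rewrite imset_f // inE.
    case: (boolP (i \in S)) => //= /imsetP[t' _ e]; rewrite e hf.
    case: eqP => [/val_inj tt'|]; last by rewrite andbF.
    by rewrite e tt' eqxx in ift.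
  have ftV : f t \in block blk V t by rewrite inE hf eqxx andbT; have [] := transversal_blk fF t.
  by have := hV t; rewrite (cardsD1 (f t) (block blk V t)) ftV addnS add1n ltnS.
exists (Y :|: S); split.
- rewrite subUset (subset_trans sY (subsetDl _ _)) /=.
  by apply/subsetP => _ /imsetP[t _ ->]; have [] := transversal_blk fF t.
- by rewrite -addn1; apply: coloredU => //; exact: indep_colored.
- have dYS : [disjoint Y & S].
    rewrite disjoint_subset; apply/subsetP => i /(subsetP sY).
    by rewrite !inE => /andP[].
  rewrite cardsU (eqP (_ : Y :&: S == set0)) ?setI_eq0 // cards0 subn0 Yj.
  by rewrite /S card_imset ?cardsT ?card_ord ?mulnS 1?addnC //; exact: blk_inj hf.
Qed.

(** For each [I], the power of [M] bounds the proportion of transversals agreeing with a given one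
    on [I], and the exponential bounds the gain in joint probability. *)
Definition overlap_sum (R : realType) (s M : nat) (phi : nat -> nat -> R) : R :=
  \sum_(I : {set 'I_s} | (1 < #|I|)%N) expR (pair_energy phi I) * M%:R^-1 ^+ #|I|.

(** Two bad events: some admissible V has no independent transversal (the union over V puts n into
    the exponent), or some small set has large minimum degree. Outside them, [k - M] transversals
    take one colour each and the at most [m] other vertices are coloured greedily. *)
Lemma chi_upper_prob (R : realType) (n s k M m d : nat) (q : 'I_n -> 'I_n -> R)
    (blk : 'I_n -> nat) (phi : nat -> nat -> R) (p rho : R) :
  edge_law q -> (forall i j, q i j <= 2 * p) -> 0 <= p ->
  (forall i j, phi i j = phi j i) ->
  (forall i j, expR (- phi (blk i) (blk j)) <= 1 - q i j) ->
  (1 < s)%N -> (0 < M <= k)%N -> (forall t : 'I_s, #|block blk [set: 'I_n] t| = k) ->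
  (n <= m + s * (k - M))%N ->
  overlap_sum s M phi <= rho ->
  8 * p * m%:R <= d%:R -> n%:R * expR (- (p * m%:R / 2)) <= 1 ->
  graph_prob q (fun G => (k + d < chi G)%N)
  <= expR (n%:R - (4 * rho)^-1) + expR (1 - p * m%:R / 2).
Proof.
move=> hq qp p0 symphi hphi s1 /andP[M0 Mk] hblk nm hrho md hn.
pose B1 (G : {set 'I_n * 'I_n}) := [exists V : {set 'I_n}, [forall t : 'I_s, (M <= #|block blk V t|)%N] &&
  [forall f, (f \in transversals s blk V) ==> ~~ [disjoint inner (f @: [set: 'I_s]) & G]]].
pose B2 (G : {set 'I_n * 'I_n}) := [exists X : {set 'I_n}, (1 <= #|X| <= m)%N &&
      [forall x in X, (d <= #|[set y in X | adj G x y]|)%N]].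
have b1 : graph_prob q B1 <= expR (n%:R - (4 * rho)^-1).
  apply: le_trans (graph_probU _ _ hq) _.
  apply: (@le_trans _ _ (\sum_(V : {set 'I_n} | 0 <= #|V|%:R :> R) 1 ^+ #|V| * expR (- (4 * rho)^-1))).
    rewrite [leLHS]big_mkcond [leRHS]big_mkcond; apply: ler_sum => V _.
    rewrite ler0n expr1n mul1r.
    case: ifP => [/forallP hV|_]; last exact: expR_ge0.
    exact: transversal_prob hrho.
  rewrite -mulr_suml expRD ler_wpM2r ?expR_ge0 //.
  (* With z = 1 and b = 0 this only says that there are at most e^n vertex sets. *)
  apply: le_trans (sum_large_sets _ _ (b := 0) _ _) _ => //.
  by rewrite expR0 !mul1r mulr0 subr0 card_ord.
have b2 : graph_prob q B2 <= expR (1 - p * m%:R / 2) by exact: sparse_prob.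
apply: le_trans (lerD b1 b2); apply: le_trans (graph_prob_or _ _ hq).
apply: graph_prob_le => // G sG; apply: contraTT; rewrite negb_or -leqNgt => /andP[g1 g2].
have [||Y [sY cY Yj]] := @extract_colored n s M blk G sG _ (k - M) setT.
- move=> V hV; move: g1; rewrite negb_exists => /forallP/(_ V).
  rewrite (introT forallP hV) /= negb_forall => /existsP[f].
  by rewrite negb_imply negbK => /andP[]; exists f.
- by move=> t; rewrite hblk subnKC.
apply: colored_chi => //.
have cX : colored G (~: Y) d.
  apply: degenerate_colored => // X sX X0.
  have Xm : (1 <= #|X| <= m)%N.
    rewrite card_gt0 X0 /=; apply: leq_trans (subset_leq_card sX) _.
    rewrite cardsCs setCK Yj card_ord leq_subLR addnC //.
  move: g2; rewrite negb_exists => /forallP/(_ X); rewrite Xm /= negb_forall.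
  by case/existsP=> x; rewrite negb_imply -ltnNge => /andP[]; exists x.
apply: coloredS (coloredU cY cX); last by rewrite setUCr.
by rewrite leq_add2r leq_subr.
Qed.

(* The pair energy is at most 2|I| while p|I| <= 1, and below the threshold
   (1 - d) L |I| always; the two ranges of |I| are summed separately. *)
Lemma overlap_sum_le (R : realType) (s M : nat) (phi : nat -> nat -> R) (p L d b : R) :
  0 < p -> (0 < M)%N -> 0 <= b -> 0 <= d * L ->
  (forall I : {set 'I_s}, pair_energy phi I <= 2 * p * #|I|%:R ^+ 2) ->
  (forall I : {set 'I_s}, (0 < #|I|)%N -> pair_energy phi I <= (1 - d) * L * #|I|%:R) ->
  expR b * (expR 2 / M%:R) * s%:R <= 1 ->
  expR (d * L / 2) * (expR ((1 - d) * L) / M%:R) * s%:R <= p^-1 ->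
  overlap_sum s M phi <= expR (1 - 2 * b) + expR (p^-1 * (1 - d * L / 2)).
Proof.
move=> p0 M0 b0 dL H1 H2 c1 c2.
have M0R : 0 < M%:R :> R by rewrite ltr0n.
pose z1 : R := expR 2 / M%:R; pose z2 := expR ((1 - d) * L) / M%:R.
have z10 : 0 <= z1 by rewrite divr_ge0 ?expR_ge0 // ltW.
have z20 : 0 <= z2 by rewrite divr_ge0 ?expR_ge0 // ltW.
apply: (@le_trans _ _ (\sum_(I : {set 'I_s} | 2 <= #|I|%:R :> R) z1 ^+ #|I| +
   \sum_(I : {set 'I_s} | p^-1 <= #|I|%:R :> R) z2 ^+ #|I|)); last first.
  apply: lerD.
    apply: le_trans (sum_large_sets _ _ z10 b0) _.
    by rewrite ler_expR card_ord [2 * b]mulrC lerD2r.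
  apply: le_trans (sum_large_sets _ _ z20 (_ : 0 <= d * L / 2)) _; first exact: divr_ge0.
  by rewrite ler_expR card_ord mulrBr mulr1 [p^-1 * _]mulrC lerD2r.
rewrite /overlap_sum [leLHS]big_mkcond [X in X + _]big_mkcond [X in _ + X]big_mkcond -big_split /=.
apply: ler_sum => I _; rewrite (ler_nat R 2); case: ifP => [I2|_]; last first.
  by rewrite add0r; case: ifP => // _; exact: exprn_ge0.
have I0 : (0 < #|I|)%N by exact: ltn_trans I2.
case: (lerP p^-1 #|I|%:R) => [big|small].
  rewrite -[leLHS]add0r lerD ?exprn_ge0 // /z2 exprMn -expRM_natr.
  by rewrite ler_wpM2r ?exprn_ge0 ?invr_ge0 ?ler_expR ?ler0n // H2.
rewrite addr0 /z1 exprMn -expRM_natr ler_wpM2r ?exprn_ge0 ?invr_ge0 ?ler0n // ler_expR.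
apply: (le_trans (H1 I)); rewrite expr2.
have px : p * #|I|%:R <= 1 by rewrite -[leRHS](@mulfV _ p) ?gt_eqF // ler_wpM2l ?(ltW p0) ?(ltW small).
by have := ler_wpM2l (ler0n R #|I|) px; lra.
Qed.

(** Here [c] bounds k L / (p n) from below. [E1] controls the small overlaps, [E2] the large ones,
    and [E3] yields p k >= 4 L, which beats ln n <= 2 L in the sparse remainder. *)
Lemma chi_upper (R : realType) (n k : nat) (q : 'I_n -> 'I_n -> R)
    (blk : 'I_n -> nat) (phi : nat -> nat -> R) (p L c d eps : R) :
  edge_law q -> (forall i j, q i j <= 2 * p) ->
  (forall i j, phi i j = phi j i) ->
  (forall i j, expR (- phi (blk i) (blk j)) <= 1 - q i j) ->
  (forall I : {set 'I_(n %/ k)}, pair_energy phi I <= 2 * p * #|I|%:R ^+ 2) ->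
  (forall I : {set 'I_(n %/ k)}, (0 < #|I|)%N ->
     pair_energy phi I <= (1 - d) * L * #|I|%:R) ->
  (forall t : 'I_(n %/ k), #|block blk [set: 'I_n] t| = k) ->
  0 < p -> p <= 4^-1 -> 16 * p <= d -> 0 < c -> 3 <= L -> 4 <= d * L ->
  p * n%:R = expR L -> n%:R <= expR (2 * L) -> expR (4 * eps * L) <= p ^+ 4 * n%:R ->
  expR 5 * L ^+ 4 <= c ^+ 2 * expR (2 * eps * L) ->
  L ^+ 4 <= c ^+ 2 * expR (d * L / 2) ->
  4 * L ^+ 2 <= c * expR (4 * eps * L) ->
  (2 <= k)%N -> c * (p * n%:R) <= k%:R * L -> k%:R <= p * n%:R ->
  exists2 d' : nat, d'%:R <= 8 * p * (k%:R + n%:R / L ^+ 2 + L / (c * p)) + 1 &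
    graph_prob q (fun G => (k + d' < chi G)%N) <= expR (- n%:R) + expR (1 - 2 * L).
Proof.
move=> hq qp symphi hphi H1 H2 hblk p0 p4 pd c0 L3 dL pn nL p4n E1 E2 E3 k2 ck kp.
set s := (n %/ k)%N in H1 H2 hblk *.
have L0 : 0 < L by lra.
have L20 : 0 < L ^+ 2 by exact: exprn_gt0.
have n0 : 0 < n%:R :> R.
  by have := expR_gt0 L; rewrite -pn pmulr_rgt0.
have k0n : (0 < k)%N by exact: leq_trans k2.
have k0 : 0 < k%:R :> R by rewrite ltr0n.
have k2R : 2 <= k%:R :> R by rewrite (ler_nat R 2).
have skn : s%:R * k%:R <= n%:R :> R by rewrite -natrM ler_nat leq_trunc_div.
have s0 : 0 <= s%:R :> R by exact: ler0n.
have s1 : (1 < s)%N.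
  rewrite leq_divRL // mulnC -(ler_nat R) natrM.
  have := ler_wpM2r (ltW n0) p4; lra.
(* Rounded up, so that M is positive and k <= M L^2. *)
pose M := (Num.truncn (k%:R / L ^+ 2)).+1.
have kM : k%:R <= M%:R * L ^+ 2.
  by rewrite -ler_pdivrMr // ltW // truncnS_gt.
have M0 : 0 < M%:R :> R by rewrite ltr0n.
have Mk1 : M%:R <= k%:R / L ^+ 2 + 1.
  by rewrite /M -natr1 lerD2r truncn_le divr_ge0 ?(ltW k0) ?(ltW L20).
have Mk : (M <= k)%N.
  rewrite -(ler_nat R); apply: le_trans Mk1 _.
  have : k%:R / L ^+ 2 <= k%:R / 2.
    rewrite ler_pM2l // lef_pV2 ?posrE //.
    by have := ler_wpM2l (ltW L0) L3; rewrite expr2; lra.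
  lra.
(* Left over are fewer than k vertices beyond the last full block and M in each of the s blocks. *)
pose m := (k + s * M)%N; pose d' := (Num.truncn (8 * p * m%:R)).+1.
have mE : m%:R = k%:R + s%:R * M%:R :> R by rewrite natrD natrM.
have sL : s%:R <= L / (c * p).
  rewrite ler_pdivlMr ?mulr_gt0 //.
  have h1 : s%:R * (c * (p * n%:R)) <= s%:R * (k%:R * L) by rewrite ler_wpM2l.
  have h2 : s%:R * k%:R * L <= n%:R * L by rewrite ler_pM2r.
  rewrite -(ler_pM2r n0); lra.
have sM : s%:R * M%:R <= n%:R / L ^+ 2 + L / (c * p).
  apply: le_trans (ler_wpM2l s0 Mk1) _; rewrite mulrDr mulr1 lerD //.
  by rewrite mulrA ler_pM2r // invr_gt0.
exists d'.
  have m0 : 0 <= 8 * p * m%:R by rewrite !mulr_ge0 // ltW.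
  rewrite /d' -natr1 lerD2r; apply: (@le_trans _ _ (8 * p * m%:R)).
    by rewrite truncn_le.
  by rewrite ler_pM2l ?mulr_gt0 // mE -addrA lerD2l.
(* This is s / M <= L^4 / (c^2 p^2 n), from s k <= n, k <= M L^2 and c p n <= k L. *)
have key : s%:R * (c ^+ 2 * p ^+ 2 * n%:R) <= L ^+ 4 * M%:R.
  rewrite -(ler_pM2r n0).
  have cpn0 : 0 <= c * (p * n%:R) by rewrite !mulr_ge0 ?ltW.
  have h1 : s%:R * (c * (p * n%:R)) ^+ 2 <= s%:R * (k%:R * L) ^+ 2.
    by rewrite ler_wpM2l // lerXn2r ?nnegrE ?mulr_ge0 // ltW.
  have h2 : (s%:R * k%:R) * (k%:R * L ^+ 2) <= n%:R * (k%:R * L ^+ 2).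
    by rewrite ler_wpM2r // mulr_ge0 // ltW.
  have h3 : (n%:R * L ^+ 2) * k%:R <= (n%:R * L ^+ 2) * (M%:R * L ^+ 2).
    by rewrite ler_wpM2l // mulr_ge0 // ltW.
  rewrite [leLHS](_ : _ = s%:R * (c * (p * n%:R)) ^+ 2); last by ring.
  apply: (le_trans h1); rewrite [leLHS](_ : _ = (s%:R * k%:R) * (k%:R * L ^+ 2)); last by ring.
  apply: (le_trans h2); rewrite [leLHS](_ : _ = (n%:R * L ^+ 2) * k%:R); last by ring.
  by apply: (le_trans h3); rewrite le_eqVlt; apply/orP; left; apply/eqP; ring.
pose r := expR (ln (n%:R : R) / 2).
have r0 : 0 < r by exact: expR_gt0.
have r2 : r ^+ 2 = n%:R by rewrite -expRM_natr divfK ?pnatr_eq0 // lnK.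
(* The square root of the hypothesis on p^4 n, since [r] is the square root of n. *)
have pr : expR (2 * eps * L) <= p ^+ 2 * r.
  rewrite -(@ler_pXn2r _ 2) ?nnegrE ?expR_ge0 //; last by rewrite mulr_ge0 ?exprn_ge0 // ltW.
  rewrite -expRM_natr exprMn r2 -exprM; apply: le_trans p4n.
  by rewrite ler_expR; lra.
have pk : 4 * L <= p * k%:R.
  have h1 : p * (c * (p * n%:R)) <= p * (k%:R * L) by rewrite ler_pM2l.
  have h2 : p ^+ 4 * n%:R <= p ^+ 2 * n%:R.
    rewrite ler_pM2r // -[4%N]/(2 + 2)%N exprD -[leRHS]mulr1 ler_wpM2l ?exprn_ge0 ?(ltW p0) //.
    by rewrite exprn_ile1 ?(ltW p0) //; lra.
  have h3 := ler_wpM2l (ltW c0) (le_trans p4n h2).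
  rewrite -(ler_pM2r L0); rewrite expr2 in E3 h3; lra.
have pm : 4 * L <= p * m%:R.
  by apply: le_trans pk _; rewrite ler_pM2l // mE lerDl mulr_ge0.
have nr : ln (n%:R : R) <= 2 * L by rewrite -ler_expR lnK.
have ln0 : 0 <= ln (n%:R : R) by rewrite ln_ge0 // ler1n -(ltr0n R).
(* b makes the small-overlap part of the sum a small multiple of 1 / n. *)
pose b := ln (n%:R : R) / 2 + 3.
pose rho : R := 2 * expR (- 5) / n%:R.
have hrho : overlap_sum s M phi <= rho.
  have b0 : 0 <= b by rewrite /b; lra.
  have dL0 : 0 <= d * L by lra.
  have cond1 : expR b * (expR 2 / M%:R) * s%:R <= 1.
    rewrite mulrA mulrAC ler_pdivrMr // mul1r -expRD.
    have -> : expR (b + 2) = expR 5 * r by rewrite -expRD; congr expR; rewrite /b; ring.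
    have x0 : 0 < c ^+ 2 * p ^+ 2 * r by rewrite !mulr_gt0 ?exprn_gt0.
    rewrite -(ler_pM2r x0) [leLHS](_ : _ = expR 5 * (s%:R * (c ^+ 2 * p ^+ 2 * n%:R))); last first.
      by rewrite -r2; ring.
    apply: le_trans (ler_wpM2l (expR_ge0 _) key) _.
    have h : expR 5 * L ^+ 4 <= c ^+ 2 * (p ^+ 2 * r).
      by apply: (le_trans E1); rewrite ler_wpM2l // exprn_ge0 // ltW.
    by have := ler_wpM2l (ltW M0) h; lra.
  (* Writing e^((1 - d/2) L) as p n e^(-d L / 2) reduces this to [key] and [E2]. *)
  have cond2 : expR (d * L / 2) * (expR ((1 - d) * L) / M%:R) * s%:R <= p^-1.
    rewrite mulrA mulrAC ler_pdivrMr // -expRD [leRHS]mulrC ler_pdivlMr //.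
    have c20 : 0 < c ^+ 2 * expR (d * L / 2) by rewrite mulr_gt0 ?exprn_gt0 ?expR_gt0.
    rewrite -(ler_pM2r c20).
    rewrite [leLHS](_ : _ = s%:R * (c ^+ 2 * p ^+ 2 * n%:R)); last first.
      have -> : c ^+ 2 * p ^+ 2 * n%:R = c ^+ 2 * p * (p * n%:R) by ring.
      rewrite pn (_ : expR L = expR (d * L / 2 + (1 - d) * L) * expR (d * L / 2)); last first.
        by rewrite -expRD; congr expR; lra.
      by ring.
    apply: (le_trans key); have := ler_wpM2l (ltW M0) E2; lra.
  apply: le_trans (overlap_sum_le p0 _ b0 dL0 H1 H2 cond1 cond2) _ => //.
  have -> : rho = expR (- 5 - ln n%:R) + expR (- 5 - ln n%:R).
    by rewrite expRD expRN lnK // /rho; lra.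
  apply: lerD; rewrite ler_expR; first by rewrite /b; lra.
  (* The target exponent is -5 - ln n, and 5 + ln n <= 5 + 2 L <= 4 L. *)
  suff : 4 * L <= p^-1 * (d * L / 2 - 1) by lra.
  rewrite [leRHS]mulrC ler_pdivlMr //; have := ler_wpM2r (ltW L0) pd; lra.
have rho0 : 0 < rho by rewrite !mulr_gt0 ?expR_gt0 ?invr_gt0.
apply: le_trans (chi_upper_prob (m := m) (d := d') hq qp (ltW p0) symphi hphi s1 _ hblk _ hrho _ _) _.
- by rewrite Mk.
- rewrite /m -addnA -mulnDr subnKC // addnC [X in (X <= _)%N](divn_eq n k) leq_add2l.
  by rewrite ltnW // ltn_pmod.
- by rewrite ltW // truncnS_gt.
- rewrite -{1}[n%:R]lnK // -expRD -[leRHS]expR0 ler_expR; lra.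
apply: lerD; rewrite ler_expR; last by lra.
(* Then (4 rho)^-1 = n e^5 / 8 >= 4 n, more than enough against the e^n sets V. *)
have e5 : 32 <= expR 5 :> R.
  have h := expR_ge1Dx (1 : R).
  have -> : expR 5 = expR 1 ^+ 5 :> R by rewrite -expRM_natr mul1r.
  apply: (@le_trans _ _ (2 ^+ 5)); first by lra.
  by rewrite lerXn2r ?nnegrE ?expR_ge0 //; lra.
have -> : (4 * rho)^-1 = n%:R * expR 5 / 8.
  by rewrite /rho expRN; field; rewrite !gt_eqF ?expR_gt0.
have := ler_wpM2l (ltW n0) e5; lra.
Qed.

(** * Lower bound *)

(** First moment: a bad S is independent with probability at most z^|S|. Taking b = d L in the sum
    over large sets turns e^b z n into e n e^(-L) = e / p, while the size bound L / p contributes -d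
    L^2 / p. The - 1 in the hypothesis on the edge sum leaves room for diagonal terms. *)
Lemma bad_indep_prob (R : realType) (n : nat) (q : 'I_n -> 'I_n -> R) (p L d : R)
    (bad : pred {set 'I_n}) :
  edge_law q -> 0 < p -> 0 <= d * L -> p * n%:R = expR L ->
  (forall S : {set 'I_n}, bad S -> L / p <= #|S|%:R) ->
  (forall S : {set 'I_n}, bad S ->
     ((1 + d) * L - 1) * #|S|%:R <= \sum_(e in inner S) q e.1 e.2) ->
  graph_prob q (fun G => [exists S, bad S && [disjoint inner S & G]])
  <= expR ((4 - d * L ^+ 2) / p).
Proof.
move=> hq p0 dL pn hs he; apply: le_trans (graph_probU _ _ hq) _.
set z := expR (1 - (1 + d) * L).
apply: (@le_trans _ _ (\sum_(S : {set 'I_n} | L / p <= #|S|%:R) z ^+ #|S|)); last first.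
  apply: le_trans (sum_large_sets _ _ (expR_ge0 _) dL) _.
  rewrite ler_expR card_ord -expRD mulrBl; apply: lerB; last first.
    by rewrite le_eqVlt; apply/orP; left; apply/eqP; ring.
  rewrite ler_pdivlMr // -mulrA [n%:R * p]mulrC pn -expRD.
  by rewrite [X in expR X](_ : _ = 1) ?expR1_le4 //; ring.
rewrite [leLHS]big_mkcond [leRHS]big_mkcond; apply: ler_sum => S _.
case: ifP => [bS|_]; last by case: ifP => // _; rewrite exprn_ge0 ?expR_ge0.
rewrite hs // graph_probE (prob_absent q (inner_sub S)).
apply: (@le_trans _ _ (\prod_(e in inner S) expR (- q e.1 e.2))).
  apply: ler_prod => e _; rewrite subr_ge0 expR_ge1Dx andbT.
  by have /andP[] := hq e.1 e.2.
rewrite -expR_sum -expRM_natr ler_expR sumrN.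
by have := he S bS; lra.
Qed.

Lemma sum_inner_diag (R : numDomainType) (n : nat) (F : 'I_n -> 'I_n -> R) (S : {set 'I_n}) :
  (forall i j, F i j = F j i) ->
  (\sum_(e in inner S) F e.1 e.2) *+ 2 =
  \sum_(i in S) \sum_(j in S) F i j - \sum_(i in S) F i i.
Proof.
move=> symF; rewrite sum_inner // -sumrB; apply: eq_bigr => i iS.
by rewrite [in RHS](bigD1 i) //= [RHS]addrC addKr.
Qed.

Lemma sum_le_card (R : numDomainType) (n : nat) (u : 'I_n -> R) (S : {set 'I_n}) :
  (forall i, 0 <= u i <= 1) -> 0 <= \sum_(i in S) u i <= #|S|%:R.
Proof.
move=> u01; apply/andP; split; first by apply: sumr_ge0 => i _; have /andP[] := u01 i.
by rewrite -sumr_const; apply: ler_sum => i _; have /andP[] := u01 i.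
Qed.

(** The classes are cut down to an arbitrary [U] because the product model needs them for each set
    competing in the maximum. *)
Lemma color_classes (n : nat) (G : {set 'I_n * 'I_n}) : G \subset vpairs n ->
  exists f : 'I_n -> 'I_(chi G), forall (U : {set 'I_n}) c,
    [disjoint inner [set i in U | f i == c] & G].
Proof.
move=> sG; have [/existsP[f /forallP hf] _] := chromatic_numberP (adj_irr sG).
exists f => U c; rewrite indep_adj //; apply/'forall_implyP => i; rewrite inE => /andP[_ /eqP fi].
apply/'forall_implyP => j; rewrite inE => /andP[_ /eqP fj].
apply: contraTN (forallP (hf i) j) => ij; rewrite ij /= negbK.
by apply/eqP; rewrite fi fj.
Qed.

(** Cauchy-Schwarz, from the nonnegativity of the sum of all (a i - a j)^2. *)
Lemma sqr_sum_le (R : realFieldType) (I : finType) (a : I -> R) :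
  (\sum_i a i) ^+ 2 <= #|I|%:R * \sum_i a i ^+ 2.
Proof.
have h : 0 <= \sum_i \sum_j (a i - a j) ^+ 2.
  by apply: sumr_ge0 => i _; apply: sumr_ge0 => j _; exact: sqr_ge0.
have e : \sum_i \sum_j (a i - a j) ^+ 2 =
    2 * (#|I|%:R * \sum_i a i ^+ 2) - 2 * (\sum_i a i) ^+ 2.
  have inn i : \sum_j (a i - a j) ^+ 2 =
      #|I|%:R * a i ^+ 2 + \sum_j a j ^+ 2 - 2 * (a i * \sum_j a j).
    rewrite (eq_bigr (fun j => a i ^+ 2 + a j ^+ 2 - 2 * (a i * a j))) => [|j _]; last by ring.
    by rewrite sumrB big_split /= sumr_const -[_ *+ _]mulr_natl -!mulr_sumr.
  under eq_bigr => i _ do rewrite inn.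
  rewrite sumrB big_split /= sumr_const -[_ *+ _]mulr_natl -!mulr_sumr -mulr_suml.
  by ring.
rewrite e in h; lra.
Qed.

Lemma chi_ge_times (R : realFieldType) (n : nat) (u : 'I_n -> R) (p K : R)
    (G : {set 'I_n * 'I_n}) :
  G \subset vpairs n -> 0 < p -> 0 <= K ->
  ~~ [exists S : {set 'I_n}, (K * #|S|%:R < p * (\sum_(i in S) u i) ^+ 2) && [disjoint inner S & G]] ->
  p * max_density u <= K * (chi G)%:R.
Proof.
move=> sG p0 Kge0; rewrite negb_exists => /forallP h; have [f hf] := color_classes sG.
have K0 (U : {set 'I_n}) : (0 < #|U|)%N -> p * (\sum_(i in U) u i) ^+ 2 <= (K * (chi G)%:R) * #|U|%:R.
  move=> U0; rewrite (partition_big f xpredT) //=.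
  apply: le_trans (ler_wpM2l (ltW p0) (sqr_sum_le _)) _.
  rewrite card_ord mulrCA mulrAC [leRHS]mulrC ler_wpM2l // mulr_sumr.
  have -> : #|U| = (\sum_(c < chi G) #|[set i in U | f i == c]|)%N.
    rewrite -sum1_card (partition_big f xpredT) //=; apply: eq_bigr => c _.
    by rewrite -sum1_card; apply: eq_bigl => i; rewrite inE.
  rewrite natr_sum mulr_sumr; apply: ler_sum => c _.
  have := h [set i in U | f i == c]; rewrite hf andbT -leNgt => le.
  rewrite (eq_bigl (fun i => i \in [set i in U | f i == c])) //.
  by move=> i; rewrite inE.
rewrite /max_density mulrC -ler_pdivlMr //; apply: (big_ind (fun x => x <= _ / p)) => [|x y hx hy|U U0].
- by rewrite ler_pdivlMr // mul0r mulr_ge0.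
- by rewrite ge_max hx hy.
- by rewrite ler_pdivlMr // -mulrA ler_pdivrMl ?ltr0n // mulrC [leRHS]mulrC; exact: K0.
Qed.

Lemma chi_ge_plus (R : realFieldType) (n : nat) (u : 'I_n -> R) (p K : R)
    (G : {set 'I_n * 'I_n}) :
  G \subset vpairs n ->
  ~~ [exists S : {set 'I_n}, (K < p * \sum_(i in S) u i) && [disjoint inner S & G]] ->
  p * \sum_i u i <= K * (chi G)%:R.
Proof.
move=> sG; rewrite negb_exists => /forallP h; have [f hf] := color_classes sG.
rewrite (partition_big f xpredT) //= mulr_sumr mulr_natr -[X in _ *+ X]card_ord -sumr_const.
apply: ler_sum => c _; have := h [set i in [set: 'I_n] | f i == c]; rewrite hf andbT -leNgt.
suff -> : \sum_(i in [set i in [set: 'I_n] | f i == c]) u i = \sum_(i | f i == c) u i by [].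
by apply: eq_bigl => i; rewrite !inE.
Qed.

(** The double sum p u(S)^2 contains the diagonal terms p u_i^2, which are no edges; they cost at
    most |S|. *)
Lemma times_inner_ge (R : realFieldType) (n : nat) (u : 'I_n -> R) (p : R) (S : {set 'I_n}) :
  (forall i, 0 <= u i <= 1) -> 0 <= p <= 1 ->
  p * (\sum_(i in S) u i) ^+ 2 / 2 - #|S|%:R <= \sum_(e in inner S) p * u e.1 * u e.2.
Proof.
move=> u01 /andP[p0 p1].
have := sum_inner_diag (F := fun i j => p * u i * u j) S (fun i j => mulrAC _ _ _).
have -> : \sum_(i in S) \sum_(j in S) p * u i * u j = p * (\sum_(i in S) u i) ^+ 2.
  rewrite expr2 mulr_suml mulr_sumr; apply: eq_bigr => i _.
  by rewrite mulrA mulr_sumr.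
have : \sum_(i in S) p * u i * u i <= #|S|%:R.
  rewrite -sumr_const; apply: ler_sum => i _; have /andP[u0 u1] := u01 i.
  by rewrite !mulr_ile1 ?mulr_ge0.
have x0 : 0 <= #|S|%:R :> R by exact: ler0n.
by lra.
Qed.

Lemma plus_inner_ge (R : realFieldType) (n : nat) (u : 'I_n -> R) (p : R) (S : {set 'I_n}) :
  (forall i, 0 <= u i <= 1) -> 0 <= p <= 1 ->
  p * (\sum_(i in S) u i) * #|S|%:R - #|S|%:R <= \sum_(e in inner S) p * (u e.1 + u e.2).
Proof.
move=> u01 /andP[p0 p1].
have := sum_inner_diag (F := fun i j => p * (u i + u j)) S
  (fun i j => congr1 _ (addrC _ _)).
have -> : \sum_(i in S) \sum_(j in S) p * (u i + u j) = 2 * (p * (\sum_(i in S) u i) * #|S|%:R).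
  under eq_bigr => i _ do rewrite -mulr_sumr big_split /= sumr_const.
  by rewrite -mulr_sumr big_split /= sumr_const sumrMnl; ring.
have -> : \sum_(i in S) p * (u i + u i) = 2 * (p * \sum_(i in S) u i).
  by rewrite !mulr_sumr; apply: eq_bigr => i _; ring.
have /andP[S0 S1] := sum_le_card S u01.
have : p * \sum_(i in S) u i <= #|S|%:R.
  by rewrite -[leRHS]mul1r ler_pM.
by lra.
Qed.

(** * Blocks of the ordered vertex set *)

Lemma exists_rank (R : realDomainType) (n : nat) (u : 'I_n -> R) :
  exists2 rk : 'I_n -> 'I_n, injective rk & forall i j, (rk i < rk j)%N -> u j <= u i.
Proof.
pose r := sort (fun i j => u j <= u i) (enum 'I_n).
have mem i : i \in r by rewrite mem_sort mem_enum.
have sz : size r = n by rewrite size_sort size_enum_ord.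
have lt i : (index i r < n)%N by rewrite -[n in (_ < n)%N]sz index_mem.
exists (fun i => Ordinal (lt i)).
  by move=> i j /(congr1 val) /= e; rewrite -(nth_index i (mem i)) e nth_index.
move=> i j /= ij.
have srt : sorted (fun i j => u j <= u i) r by apply: sort_sorted => a b; exact: le_total.
have tr : transitive (fun i j : 'I_n => u j <= u i) by move=> b a c ab bc; exact: le_trans bc ab.
have := sorted_ltn_nth tr i srt (index i r) (index j r).
rewrite !inE !index_mem !mem => /(_ isT isT ij).
by rewrite !nth_index.
Qed.

Lemma card_block_rank (n k : nat) (rk : 'I_n -> 'I_n) (t : 'I_(n %/ k)) :
  injective rk -> (0 < k)%N -> #|block (fun i => rk i %/ k)%N [set: 'I_n] t| = k.
Proof.
move=> rinj k0.
have lt (a : 'I_k) : (t * k + a < n)%N.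
  apply: (@leq_trans (t.+1 * k)); first by rewrite mulSn addnC ltn_add2r.
  by apply: leq_trans (leq_trunc_div n k); rewrite leq_mul2r ltn_ord orbT.
pose g (a : 'I_k) := Ordinal (lt a).
have ginj : injective g by move=> a b /(congr1 val) /= /addnI /val_inj.
transitivity #|rk @^-1: (g @: [set: 'I_k])|; last first.
  by rewrite card_preimset // card_imset // cardsT card_ord.
apply: eq_card => i; rewrite !inE /=; apply/eqP/imsetP => [e|[a _ ->]]; last first.
  by rewrite /= divnMDl // (divn_small (ltn_ord a)) addn0.
have lk : (rk i %% k < k)%N by rewrite ltn_pmod.
by exists (Ordinal lk); rewrite ?inE //; apply: ord_inj; rewrite /= -e -divn_eq.
Qed.

Definition block_max (R : realDomainType) (n : nat) (u : 'I_n -> R) (blk : 'I_n -> nat)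
  (t : nat) : R := \big[Num.max/0]_(i | blk i == t) u i.

Lemma block_max_01 (R : realDomainType) (n : nat) (u : 'I_n -> R) (blk : 'I_n -> nat) t :
  (forall i, 0 <= u i <= 1) -> 0 <= block_max u blk t <= 1.
Proof.
move=> u01; apply: (big_ind (fun x => 0 <= x <= 1)) => [|x y|i _] //.
- by rewrite lexx ler01.
- by move=> /andP[x0 x1] /andP[y0 y1]; rewrite le_max x0 /= ge_max x1 y1.
Qed.

Lemma le_block_max (R : realDomainType) (n : nat) (u : 'I_n -> R) (blk : 'I_n -> nat) i :
  u i <= block_max u blk (blk i).
Proof. by rewrite /block_max (bigD1 i) //= le_max lexx. Qed.

Lemma block_max_le (R : realDomainType) (n : nat) (u : 'I_n -> R) (blk : 'I_n -> nat) i t :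
  (forall j, 0 <= u j <= 1) -> (forall j l, (blk j < blk l)%N -> u l <= u j) ->
  (blk i < t)%N -> block_max u blk t <= u i.
Proof.
move=> u01 dec it; apply: (big_ind (fun x => x <= u i)) => [|x y hx hy|j /eqP jt].
- by have /andP[] := u01 i.
- by rewrite ge_max hx hy.
- by apply: dec; rewrite jt.
Qed.

(* The maximum of a block is at most every value in the previous block, so the
   block maxima, apart from the first one, are dominated by block averages. *)
Lemma block_shift (R : realDomainType) (n s k : nat) (u : 'I_n -> R) (blk : 'I_n -> nat)
    (I : {set 'I_s}) :
  (forall j, 0 <= u j <= 1) -> (forall j l, (blk j < blk l)%N -> u l <= u j) ->
  (forall t : 'I_s, #|block blk [set: 'I_n] t| = k) ->
  exists2 U : {set 'I_n}, (#|U| <= k * #|I|)%N &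
    k%:R * (\sum_(t in I) block_max u blk t - 1) <= \sum_(i in U) u i.
Proof.
move=> u01 dec hblk; pose U := [set i | [exists t in I, (blk i).+1 == t :> nat]].
have sumU (S : nmodType) (g : 'I_n -> S) : \sum_(i in U) g i =
    \sum_(t in I | (0 < t)%N) \sum_(i | (blk i).+1 == t :> nat) g i.
  rewrite (exchange_big_dep xpredT) //= big_mkcond; apply: eq_bigr => i _.
  rewrite inE; case: existsP => [[t /andP[tI /eqP bt]]|no].
    rewrite (bigD1 t) /= ?tI -?bt ?eqxx // big1 ?addr0 // => t' /andP[/andP[_ /eqP e]].
    by rewrite -val_eqE /= -bt -e eqxx.
  rewrite big_pred0 // => t; apply/negbTE/negP => /andP[/andP[tI _] bt].
  by apply: no; exists t; rewrite tI.
have prevcard (t : 'I_s) : (0 < t)%N -> #|[set i | (blk i).+1 == t]| = k.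
  move=> t0; have lt : (t.-1 < s)%N by apply: leq_ltn_trans (ltn_ord t); exact: leq_pred.
  rewrite -(hblk (Ordinal lt)); apply: eq_card => i; rewrite !inE /=.
  by rewrite -[in LHS](prednK t0) eqSS.
exists U.
  rewrite -sum1_card sumU.
  apply: (@leq_trans (\sum_(t in I) k)); last by rewrite sum_nat_const mulnC.
  rewrite big_mkcondr; apply: leq_sum => t _; case: ifP => // t0.
  by rewrite -[X in (_ <= X)%N](prevcard t t0) -sum1_card; apply/eq_leq/eq_bigl => i; rewrite inE.
rewrite sumU.
apply: (@le_trans _ _ (k%:R * \sum_(t in I | (0 < t)%N) block_max u blk t)).
  rewrite ler_wpM2l // lerBlDr (bigID (fun t : 'I_s => (0 < t)%N)) /= lerD2l.
  have w0 t : 0 <= block_max u blk t by have /andP[] := block_max_01 blk t u01.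
  have [s0|s0] := posnP s; first by rewrite big1 ?ler01 // => t; have := ltn_ord t; rewrite {2}s0.
  apply: (@le_trans _ _ (\sum_(t | t == Ordinal s0) block_max u blk t)); last first.
    by rewrite big_pred1_eq; have /andP[] := block_max_01 blk (Ordinal s0) u01.
  rewrite big_mkcond [leRHS]big_mkcond; apply: ler_sum => t _.
  case: ifP => [/andP[_ t0]|_]; last by case: ifP.
  suff -> : t == Ordinal s0 by [].
  by rewrite -val_eqE /= -leqn0 leqNgt.
rewrite mulr_sumr; apply: ler_sum => t /andP[_ t0].
rewrite -(prevcard t t0) mulrC mulr_natr -sumr_const.
under eq_bigl => i do rewrite inE.
apply: ler_sum => i /eqP bt; apply: block_max_le => //; by rewrite -bt.
Qed.

(** With a = (1 + d) x, use e^a >= 1 + a and (1 - x)(1 + a) = 1 + x (d - a) >= 1. The factor 1 + d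
    absorbs the higher-order terms of -ln(1 - x). *)
Lemma expR_opp_le (R : realType) (d x y : R) :
  0 <= d -> 0 <= x <= y -> (1 + d) * x <= d -> expR (- ((1 + d) * y)) <= 1 - x.
Proof.
move=> d0 /andP[x0 xy] xd.
apply: (@le_trans _ _ (expR (- ((1 + d) * x)))).
  by rewrite ler_expR lerN2 ler_wpM2l // addr_ge0.
have h := expR_ge1Dx ((1 + d) * x).
have a0 : 0 <= (1 + d) * x by rewrite mulr_ge0 // addr_ge0.
rewrite expRN -div1r ler_pdivrMr ?expR_gt0 //.
have x1 : 0 <= 1 - x.
  rewrite subr_ge0; case: (lerP x 1) => // x1.
  by have := ler_wpM2l d0 (ltW x1); lra.
apply: le_trans (ler_wpM2l x1 h).
have := ler_wpM2l x0 xd; lra.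
Qed.

Lemma pair_energy_le (R : realFieldType) (s : nat) (phi : nat -> nat -> R) (I : {set 'I_s}) :
  (forall i j, 0 <= phi i j) ->
  pair_energy phi I <= (\sum_(t in I) \sum_(t' in I) phi t t') / 2.
Proof.
move=> phi0; rewrite /pair_energy ler_pM2r ?invr_gt0 //.
apply: ler_sum => t _; rewrite big_mkcondr; apply: ler_sum => t' _.
by case: ifP.
Qed.

Lemma pair_energy_le_sqr (R : realFieldType) (s : nat) (phi : nat -> nat -> R) (p : R)
    (I : {set 'I_s}) :
  (forall i j, 0 <= phi i j <= 4 * p) -> pair_energy phi I <= 2 * p * #|I|%:R ^+ 2.
Proof.
move=> h; apply: le_trans (pair_energy_le _ _) _ => [i j|]; first by have /andP[] := h i j.
apply: (@le_trans _ _ ((\sum_(t in I) \sum_(t' in I) 4 * p) / 2)).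
  rewrite ler_pM2r ?invr_gt0 //; apply: ler_sum => t _; apply: ler_sum => t' _.
  by have /andP[] := h t t'.
by rewrite !sumr_const -mulrnA -[_ *+ _]mulr_natr natrM; lra.
Qed.

Lemma max_density_ge (R : realFieldType) (n : nat) (u : 'I_n -> R) (U : {set 'I_n}) :
  (\sum_(i in U) u i) ^+ 2 <= max_density u * #|U|%:R.
Proof.
have [U0|U0] := posnP #|U|.
  by rewrite U0 mulr0 (cards0_eq U0) big_set0 expr0n.
rewrite -ler_pdivrMr ?ltr0n // mulrC /max_density (bigD1 U) //= le_max lexx //.
Qed.

Lemma max_density_ge0 (R : realFieldType) (n : nat) (u : 'I_n -> R) : 0 <= max_density u.
Proof.
rewrite /max_density; apply: (big_ind (fun x => 0 <= x)) => // [x y x0 _|U _].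
  by rewrite le_max x0.
by rewrite mulr_ge0 ?invr_ge0 // sqr_ge0.
Qed.

Lemma max_density_le (R : realFieldType) (n : nat) (u : 'I_n -> R) :
  (forall i, 0 <= u i <= 1) -> max_density u <= n%:R.
Proof.
move=> u01; apply: (big_ind (fun x => x <= n%:R)) => [|x y hx hy|U U0]; first exact: ler0n.
  by rewrite ge_max hx hy.
have /andP[S0 S1] := sum_le_card U u01.
rewrite ler_pdivrMl ?ltr0n // expr2; apply: ler_pM => //; apply: (le_trans S1).
by rewrite ler_nat -[X in (_ <= X)%N]card_ord max_card.
Qed.

(** The sum [W] of block maxima is at most 1 + u(U) / k with |U| <= k |I|, where the 1 pays for the
    first block, which no block precedes. Since u(U)^2 is at most |U| times [max_density u], the
    choice of k bounds p u(U)^2 / k^2 by about 2 L |I|. *)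
Lemma times_energy_le (R : realFieldType) (n s k : nat) (u : 'I_n -> R) (blk : 'I_n -> nat)
    (I : {set 'I_s}) (p L d : R) :
  (forall j, 0 <= u j <= 1) -> (forall j l, (blk j < blk l)%N -> u l <= u j) ->
  (forall t : 'I_s, #|block blk [set: 'I_n] t| = k) -> (0 < k)%N ->
  0 < p -> 0 < d <= 1 -> 0 < L -> (0 < #|I|)%N ->
  (1 + d / 2) * (p * max_density u) <= 2 * L * k%:R ->
  p * (1 + d / 16) * (1 + 16 / d) <= d / 8 * L ->
  pair_energy (fun t t' => (1 + d / 16) * (p * block_max u blk t * block_max u blk t')) I
    <= (1 - d / 16) * L * #|I|%:R.
Proof.
move=> u01 dec hblk k0n p0 /andP[d0 d1] L0 I0 hk hL.
have k0 : 0 < k%:R :> R by rewrite ltr0n.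
have w0 t : 0 <= block_max u blk t by have /andP[] := block_max_01 blk t u01.
apply: le_trans (pair_energy_le _ _) _ => [i j|].
  by rewrite !mulr_ge0 ?(ltW p0) // addr_ge0 // divr_ge0 // ltW.
set W := \sum_(t in I) block_max u blk t.
have -> : \sum_(t in I) \sum_(t' in I) (1 + d / 16) * (p * block_max u blk t * block_max u blk t')
   = (1 + d / 16) * p * W ^+ 2.
  rewrite expr2 /W mulr_suml mulr_sumr; apply: eq_bigr => t _.
  by rewrite mulrA mulr_sumr; apply: eq_bigr => t' _; rewrite !mulrA.
have [U cU hU] := block_shift I u01 dec hblk.
set x := (\sum_(i in U) u i) / k%:R.
have x0 : 0 <= x by rewrite divr_ge0 // sumr_ge0 // => i _; have /andP[] := u01 i.
have W0 : 0 <= W by apply: sumr_ge0.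
have Wx : W <= 1 + x by rewrite addrC -lerBlDr ler_pdivlMr // mulrC.
have iR : 1 <= #|I|%:R :> R by rewrite ler1n.
have xi : (1 + d / 2) * p * x ^+ 2 <= 2 * L * #|I|%:R.
  have h1 : (1 + d / 2) * p * (\sum_(i in U) u i) ^+ 2 <=
     (1 + d / 2) * p * (max_density u * (k%:R * #|I|%:R)).
    rewrite ler_wpM2l //; first by rewrite mulr_ge0 ?(ltW p0) // addr_ge0 // divr_ge0 // ltW.
    apply: (le_trans (max_density_ge u U)); rewrite ler_wpM2l ?max_density_ge0 //.
    by rewrite -natrM ler_nat.
  have h2 := ler_wpM2r (ler0n R (k * #|I|)) hk.
  rewrite /x expr_div_n mulrA ler_pdivrMr ?exprn_gt0 //; apply: (le_trans h1).
  rewrite natrM in h2; lra.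
(* AM-GM on the cross term 2 x of (1 + x)^2, weighted so that the coefficient of x^2 grows only to 1
   + d/16. *)
have h3 : W ^+ 2 <= (1 + 16 / d) + (1 + d / 16) * x ^+ 2.
  apply: (@le_trans _ _ ((1 + x) ^+ 2)); first by rewrite lerXn2r ?nnegrE ?addr_ge0.
  have : 0 <= d / 16 * (16 / d - x) ^+ 2 by rewrite mulr_ge0 ?sqr_ge0 // divr_ge0 // ltW.
  have -> : d / 16 * (16 / d - x) ^+ 2 = 16 / d - 2 * x + d / 16 * x ^+ 2.
    by field; rewrite gt_eqF.
  rewrite sqrrD expr1n mul1r; lra.
have D0 : 0 <= (1 + d / 16) * p by rewrite mulr_ge0 ?(ltW p0) // addr_ge0 // divr_ge0 // ltW.
have h4 := ler_wpM2l D0 h3.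
have h5 : (1 + d / 16) ^+ 2 <= (1 - d / 8) * (1 + d / 2).
  by have := ler_wpM2l (ltW d0) d1; rewrite !expr2; lra.
have px : 0 <= p * x ^+ 2 by rewrite mulr_ge0 ?sqr_ge0 // ltW.
have h6 := ler_wpM2r px h5.
have d8 : 0 <= 1 - d / 8 by lra.
have h7 := ler_wpM2l d8 xi.
have dL : 0 <= d / 8 * L by rewrite mulr_ge0 ?divr_ge0 // ltW.
have h8 := ler_wpM2l dL iR.
rewrite expr2 in h6; lra.
Qed.

(** The energy is about p W |I|, linear in [W], so the total weight takes the place of the densest
    set. *)
Lemma plus_energy_le (R : realFieldType) (n s k : nat) (u : 'I_n -> R) (blk : 'I_n -> nat)
    (I : {set 'I_s}) (p L d : R) :
  (forall j, 0 <= u j <= 1) -> (forall j l, (blk j < blk l)%N -> u l <= u j) ->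
  (forall t : 'I_s, #|block blk [set: 'I_n] t| = k) -> (0 < k)%N ->
  0 < p -> 0 < d <= 1 -> 0 < L ->
  (1 + d / 2) * (p * \sum_i u i) <= L * k%:R ->
  p * (1 + d / 16) <= d / 16 * L ->
  pair_energy (fun t t' => (1 + d / 16) * (p * (block_max u blk t + block_max u blk t'))) I
    <= (1 - d / 16) * L * #|I|%:R.
Proof.
move=> u01 dec hblk k0n p0 /andP[d0 d1] L0 hk hL.
have k0 : 0 < k%:R :> R by rewrite ltr0n.
have w0 t : 0 <= block_max u blk t by have /andP[] := block_max_01 blk t u01.
apply: le_trans (pair_energy_le _ _) _ => [i j|].
  by rewrite !mulr_ge0 ?(ltW p0) ?addr_ge0 // divr_ge0 // ltW.
set W := \sum_(t in I) block_max u blk t.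
have -> : \sum_(t in I) \sum_(t' in I) (1 + d / 16) * (p * (block_max u blk t + block_max u blk t'))
   = 2 * ((1 + d / 16) * p * W * #|I|%:R).
  under eq_bigr => i _ do rewrite -!mulr_sumr big_split /= sumr_const.
  by rewrite -!mulr_sumr big_split /= sumr_const sumrMnl -/W; ring.
have [U cU hU] := block_shift I u01 dec hblk.
set x := (\sum_i u i) / k%:R.
have x0 : 0 <= x by rewrite divr_ge0 // sumr_ge0 // => i _; have /andP[] := u01 i.
have Wx : W <= 1 + x.
  rewrite addrC -lerBlDr ler_pdivlMr // mulrC; apply: (le_trans hU).
  rewrite big_mkcond; apply: ler_sum => i _; have /andP[ui _] := u01 i; by case: ifP.
have i0 : 0 <= #|I|%:R :> R by [].
have xi : (1 + d / 2) * p * x <= L.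
  by rewrite /x mulrA ler_pdivrMr // -mulrA.
have h5 : (1 + d / 16) <= (1 - d / 8) * (1 + d / 2).
  by have := ler_wpM2l (ltW d0) d1; lra.
have D0 : 0 <= (1 + d / 16) * p by rewrite mulr_ge0 ?(ltW p0) // addr_ge0 // divr_ge0 // ltW.
have h4 := ler_wpM2l D0 Wx.
have px : 0 <= p * x by rewrite mulr_ge0 // ltW.
have h6 := ler_wpM2r px h5.
have d8 : 0 <= 1 - d / 8 by lra.
have h7 := ler_wpM2l d8 xi.
rewrite mulrAC divff ?pnatr_eq0 // mul1r ler_wpM2r //; lra.
Qed.

(** * Concentration in the two models *)

(* What the argument needs of large n, with L = ln (p n); c is a lower bound for
   Y L / (p n), where Y is the predicted chromatic number. *)
Record dense_regime (R : realType) (n : nat) (p L c d eps : R) : Prop := DenseRegime {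
  regime_p : 0 < p;
  regime_pd : 256 * p <= d;
  regime_d : 0 < d <= 1;
  regime_c : 0 < c <= 1;
  regime_L : 3 <= L;
  regime_dL : 64 <= d * c * L;
  regime_pn : p * n%:R = expR L;
  regime_n : n%:R <= expR (2 * L);
  regime_p4n : expR (4 * eps * L) <= p ^+ 4 * n%:R;
  regime_exp_2eps : expR 5 * L ^+ 4 <= c ^+ 2 * expR (2 * eps * L);
  regime_exp_d : L ^+ 4 <= c ^+ 2 * expR (d / 16 * L / 2);
  regime_exp_4eps : 4 * L ^+ 2 <= c * expR (4 * eps * L);
  regime_exp : 160 * L ^+ 2 <= d * c ^+ 2 * expR L }.

Definition color_size (R : realType) (d Y : R) : nat := (Num.truncn ((1 + d / 2) * Y)).+1.

Lemma chi_upper_regime (R : realType) (n : nat) (q : 'I_n -> 'I_n -> R)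
    (blk : 'I_n -> nat) (phi : nat -> nat -> R) (p L c d eps Y : R) :
  dense_regime n p L c d eps -> edge_law q -> (forall i j, q i j <= 2 * p) ->
  (forall i j, phi i j = phi j i) ->
  (forall i j, expR (- phi (blk i) (blk j)) <= 1 - q i j) ->
  (forall I : {set 'I_(n %/ color_size d Y)}, pair_energy phi I <= 2 * p * #|I|%:R ^+ 2) ->
  (forall I : {set 'I_(n %/ color_size d Y)}, (0 < #|I|)%N ->
     pair_energy phi I <= (1 - d / 16) * L * #|I|%:R) ->
  (forall t : 'I_(n %/ color_size d Y), #|block blk [set: 'I_n] t| = color_size d Y) ->
  c * (p * n%:R) <= Y * L -> Y * L <= p * n%:R ->
  graph_prob q (fun G => (1 + d) * Y < (chi G)%:R) <= expR (- n%:R) + expR (1 - 2 * L).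
Proof.
case=> p0 pd /andP[d0 d1] /andP[c0 c1] L3 dcL pn nL p4n E1 E2 E3 E4.
move=> hq qp symphi hphi H1 H2 hblk cY Yp; set k := color_size d Y in H1 H2 hblk.
have L0 : 0 < L by lra.
have dL : 64 <= d * L.
  by apply: le_trans dcL _; rewrite ler_pM2r // -[leRHS]mulr1 ler_pM2l.
have eL : 1 + L <= expR L by exact: expR_ge1Dx.
have n0 : 0 < n%:R :> R by have := expR_gt0 L; rewrite -pn pmulr_rgt0.
have Y0 : 0 < Y.
  by rewrite -(pmulr_lgt0 _ L0); apply: lt_le_trans cY; rewrite !mulr_gt0.
have dYc : 160 * L <= d * Y * c.
  rewrite -(ler_pM2r L0); have := ler_wpM2l (mulr_ge0 (ltW d0) (ltW c0)) cY.
  rewrite pn; rewrite !expr2 in E4; lra.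
have dYL : 160 * L <= d * Y.
  apply: (le_trans dYc); rewrite -[leRHS]mulr1 ler_pM2l //; exact: mulr_gt0.
have dY : 32 + 128 * (L / c) <= d * Y.
  have : 160 * L / c <= d * Y by rewrite ler_pdivrMr.
  have : L <= L / c by rewrite ler_pdivlMr // -[leRHS]mulr1 ler_pM2l.
  lra.
have Y1 : 160 * L <= Y.
  by apply: (le_trans dYL); rewrite -[leRHS]mul1r ler_pM2r.
have kY : (1 + d / 2) * Y <= k%:R by rewrite ltW // truncnS_gt.
have kY1 : k%:R <= (1 + d / 2) * Y + 1.
  by rewrite /k /color_size -natr1 lerD2r truncn_le mulr_ge0 ?(ltW Y0) // addr_ge0 // divr_ge0 // ltW.
have dYY : d * Y <= Y by rewrite -[leRHS]mul1r ler_pM2r.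
have dYge0 : 0 <= d * Y by rewrite mulr_ge0 // ltW.
have kge : Y <= k%:R by lra.
have kle : k%:R <= 2 * Y by lra.
have k2 : (2 <= k)%N by rewrite -(ler_nat R); lra.
have ck : c * (p * n%:R) <= k%:R * L by apply: (le_trans cY); rewrite ler_pM2r.
have kp : k%:R <= p * n%:R.
  apply: le_trans Yp; apply: (le_trans kle); rewrite mulrC ler_pM2l //; lra.
have [|||d' hd' hP] := chi_upper hq qp symphi hphi H1 H2 hblk p0 _ _ c0 L3 _ pn nL p4n E1 E2 E3 k2 ck kp.
- lra.
- lra.
- lra.
apply: le_trans hP; apply: graph_prob_le => // G _; apply: contraTT; rewrite -leqNgt -leNgt.
rewrite -(ler_nat R) natrD => /le_trans; apply.
apply: (le_trans (lerD (lexx k%:R) hd')).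
(* An excess of d Y / 2 over (1 + d/2) Y is available. The three parts of the remainder cost at most
   d Y / 16, d Y / 8 and, together with the two roundings, d Y / 16. *)
have a1 : 8 * p * k%:R <= d / 16 * Y.
  apply: (@le_trans _ _ (8 * p * (2 * Y))); first by rewrite ler_wpM2l // mulr_ge0 // ltW.
  have := ler_wpM2r (ltW Y0) pd; lra.
have a2 : 8 * p * (n%:R / L ^+ 2) <= d / 8 * Y.
  have L20 : 0 < L ^+ 2 by exact: exprn_gt0.
  rewrite mulrA ler_pdivrMr // -(ler_pM2l c0).
  have h1 : 8 * (c * (p * n%:R)) <= 8 * (Y * L) by rewrite ler_pM2l.
  have h2 : 64 * (Y * L) <= d * c * L * (Y * L) by rewrite ler_pM2r // mulr_gt0.
  rewrite expr2; lra.
have a3 : 8 * p * (L / (c * p)) = 8 * (L / c) by field; rewrite !gt_eqF.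
rewrite !mulrDr a3; lra.
Qed.

Lemma graph_prob_ge_compl (R : numDomainType) (n : nat) (q : 'I_n -> 'I_n -> R)
    (A B C : pred {set 'I_n * 'I_n}) (b c : R) : edge_law q ->
  (forall G : {set 'I_n * 'I_n}, G \subset vpairs n -> ~~ B G -> ~~ C G -> A G) ->
  graph_prob q B <= b -> graph_prob q C <= c -> 1 - (b + c) <= graph_prob q A.
Proof.
move=> hq hA hB hC; rewrite lerBlDr; apply: le_trans (lerD (lexx _) (lerD hB hC)).
apply: le_trans (lerD (lexx _) (graph_prob_or _ _ hq)).
apply: le_trans (graph_prob_or _ _ hq); rewrite -[leLHS](graph_probT q).
apply: graph_prob_le => // G sG _.
have := hA G sG; case: (A G) => //=; case: (B G) => //=; case: (C G) => //= h.
by apply: h.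
Qed.

(** Each of the three terms is at most e^(-L), and e^L >= L >= 3 / eta. *)
Lemma error_le (R : realType) (n : nat) (p L c d eps eta : R) :
  dense_regime n p L c d eps -> 0 < eta -> 3 / eta <= L ->
  expR (- n%:R) + expR (1 - 2 * L) + expR ((4 - d * L ^+ 2) / p) <= eta.
Proof.
case=> p0 pd /andP[d0 d1] /andP[c0 c1] L3 dcL pn nL p4n _ _ _ _ eta0 etaL.
have L0 : 0 < L by lra.
have dL : 64 <= d * L.
  by apply: le_trans dcL _; rewrite ler_pM2r // -[leRHS]mulr1 ler_pM2l.
have eL := expR_ge1Dx L.
have p1 : p <= 1 by lra.
have nL' : L <= n%:R.
  have : p * n%:R <= 1 * n%:R by rewrite ler_wpM2r.
  lra.
have e1 : expR (- n%:R) <= expR (- L) by rewrite ler_expR lerN2.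
have e2 : expR (1 - 2 * L) <= expR (- L) by rewrite ler_expR; lra.
have e3 : expR ((4 - d * L ^+ 2) / p) <= expR (- L).
  have h : 64 * L <= d * L ^+ 2 by rewrite expr2 mulrA ler_pM2r.
  have h2 : p * L <= 1 * L by rewrite ler_pM2r.
  rewrite ler_expR ler_pdivrMr //; lra.
have e4 : 3 * expR (- L) <= eta.
  rewrite expRN ler_pdivrMr ?expR_gt0 //; rewrite ler_pdivrMr // in etaL.
  have := ler_wpM2r (ltW eta0) eL; lra.
lra.
Qed.

Lemma times_concentration (R : realType) (n : nat) (u : 'I_n -> R) (p L c c' d eps eta Y : R) :
  (forall i, 0 <= u i <= 1) -> 0 < c -> c * n%:R <= \sum_i u i -> c' = c ^+ 2 / 2 ->
  dense_regime n p L c' d eps -> 0 < eta -> 3 / eta <= L ->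
  Y = p / (2 * L) * max_density u ->
  1 - eta <= model_times u p (fun G => (1 - d) * Y <= (chi G)%:R <= (1 + d) * Y).
Proof.
move=> u01 c0 cu c'E reg eta0 etaL defY; rewrite /model_times; have err := error_le reg eta0 etaL.
have [p0 pd /andP[d0 d1] /andP[c'0 c'1] L3 dcL pn nL p4n _ _ _ _] := reg.
have L0 : 0 < L by lra.
have dL : 64 <= d * L.
  by apply: le_trans dcL _; rewrite ler_pM2r // -[leRHS]mulr1 ler_pM2l.
have p01 : 0 <= p <= 1 by apply/andP; split; lra.
have n0 : 0 < n%:R :> R by have := expR_gt0 L; rewrite -pn pmulr_rgt0.
have uu i j : 0 <= p * u i * u j <= p.
  have /andP[ui0 ui1] := u01 i; have /andP[uj0 uj1] := u01 j.
  rewrite !mulr_ge0 ?(ltW p0) //= -mulrA -[leRHS]mulr1 ler_pM2l // mulr_ile1 //.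
have hq : edge_law (fun i j => p * u i * u j).
  by move=> i j; have /andP[h1 h2] := uu i j; rewrite h1 /=; lra.
have YE : 2 * L * Y = p * max_density u by rewrite defY; field; rewrite gt_eqF.
(* The whole vertex set competes in the maximum, so Y L >= (c^2 / 2) p n: the origin of [c']. *)
have hc : c ^+ 2 * n%:R <= max_density u.
  have := max_density_ge u [set: 'I_n]; rewrite cardsT card_ord.
  under eq_bigl => i do rewrite in_setT.
  move=> h; have h2 : (c * n%:R) ^+ 2 <= (\sum_i u i) ^+ 2.
    rewrite lerXn2r ?nnegrE ?mulr_ge0 ?(ltW c0) //.
    by apply: sumr_ge0 => i _; have /andP[] := u01 i.
  by rewrite -(ler_pM2r n0); apply: le_trans h; rewrite exprMn [n%:R ^+ 2]expr2 mulrA in h2.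
have Y0 : 0 <= Y.
  rewrite defY mulr_ge0 ?divr_ge0 ?mulr_ge0 ?(ltW p0) ?(ltW L0) //.
  by apply: le_trans hc; rewrite mulr_ge0 ?sqr_ge0.
apply: le_trans (_ : 1 - (expR (- n%:R) + expR (1 - 2 * L) + expR ((4 - d * L ^+ 2) / p)) <= _).
  by rewrite lerD2l lerN2.
pose bad (S : {set 'I_n}) := 2 * (1 + d) * L * #|S|%:R < p * (\sum_(i in S) u i) ^+ 2.
apply: (graph_prob_ge_compl (B := fun G => (1 + d) * Y < (chi G)%:R)
  (C := fun G => [exists S, bad S && [disjoint inner S & G]])) => //.
- move=> G sG; rewrite -leNgt => up /(chi_ge_times sG p0).
  rewrite up andbT -YE => h.
  (* The lower bound (1 - d) Y then follows from (1 - d)(1 + d) <= 1. *)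
  have {}h : Y <= (1 + d) * (chi G)%:R.
    rewrite -(ler_pM2l L0); have : 0 <= 2 * (1 + d) * L by rewrite !mulr_ge0 ?addr_ge0 // ltW.
    move=> /h; lra.
  have d1' : 0 <= 1 - d by lra.
  have := ler_wpM2l d1' h; have : 0 <= d * d * (chi G)%:R by rewrite !mulr_ge0 // ltW.
  lra.
- set k := color_size d Y; have k0 : (0 < k)%N by [].
  have [rk rinj rdec] := exists_rank u.
  pose blk i := (rk i %/ k)%N.
  have dec j l : (blk j < blk l)%N -> u l <= u j.
    move=> lt; apply: rdec; rewrite ltnNge; apply/negP => le.
    by move: lt; rewrite ltnNge leq_div2r.
  have hblk (t : 'I_(n %/ k)) : #|block blk [set: 'I_n] t| = k by exact: card_block_rank.
  have w01 t := block_max_01 blk t u01.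
  pose phi t t' := (1 + d / 16) * (p * block_max u blk t * block_max u blk t').
  apply: (chi_upper_regime (blk := blk) (phi := phi) reg) => //.
  + by move=> i j; have /andP[_ h] := uu i j; lra.
  + by move=> i j; rewrite /phi mulrAC.
  + move=> i j; apply: expR_opp_le; first by lra.
      have /andP[-> _] /= := uu i j; have /andP[ui0 ui1] := u01 i; have /andP[uj0 uj1] := u01 j.
      by rewrite !ler_pM ?mulr_ge0 ?(ltW p0) ?le_block_max.
    have /andP[h1 h2] := uu i j.
    have : (1 + d / 16) * (p * u i * u j) <= 2 * p by apply: ler_pM => //; lra.
    lra.
  + move=> I; apply: pair_energy_le_sqr => t t'; rewrite /phi.
    have /andP[w0 w1] := w01 t; have /andP[w0' w1'] := w01 t'.
    have W : 0 <= block_max u blk t * block_max u blk t' <= 1 by rewrite mulr_ge0 //= mulr_ile1.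
    have /andP[W0 W1] := W; rewrite -mulrA !mulr_ge0 ?(ltW p0) //=; last by lra.
    have : p * (block_max u blk t * block_max u blk t') <= p * 1 by rewrite ler_pM2l.
    move=> h; have : (1 + d / 16) * (p * (block_max u blk t * block_max u blk t')) <= 2 * (p * 1).
      by apply: ler_pM => //; [lra|rewrite mulr_ge0 // ltW|lra].
    lra.
  + move=> I I0; apply: (times_energy_le (k := k)) => //; first by rewrite d0.
      rewrite -YE; have h : (1 + d / 2) * Y <= k%:R by rewrite ltW // truncnS_gt.
      by have := ler_wpM2l (ltW L0) h; lra.
    have x1 : p * (1 + 16 / d) <= 1.
      rewrite -(ler_pM2r d0); have -> : p * (1 + 16 / d) * d = p * (d + 16) by field; rewrite gt_eqF.
      have : p * d <= p * 1 by rewrite ler_pM2l.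
      lra.
    rewrite mulrAC; have : p * (1 + 16 / d) * (1 + d / 16) <= 1 * 2.
      apply: ler_pM => //; [|lra|lra].
      by rewrite mulr_ge0 ?(ltW p0) // addr_ge0 // divr_ge0 // ltW.
    lra.
  + rewrite c'E; have := ler_wpM2l (ltW p0) hc; lra.
  + have := ler_wpM2l (ltW p0) (max_density_le u01).
    have : 0 <= p * n%:R by rewrite mulr_ge0 // ltW.
    lra.
- apply: bad_indep_prob => //; first by lra.
  + move=> S bS; have /andP[S0 S1] := sum_le_card S u01.
    (* The empty set is not bad, both sides of the strict inequality being 0; for the others u(S) <=
       |S| allows a division by |S|. *)
    have [s0|s0] := posnP #|S|.
      by move: bS; rewrite /bad s0 (cards0_eq s0) big_set0 expr0n /= !mulr0 ltxx.
    have s0R : 0 < #|S|%:R :> R by rewrite ltr0n.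
    rewrite ler_pdivrMr // -(ler_pM2r s0R).
    have h : p * (\sum_(i in S) u i) ^+ 2 <= p * #|S|%:R ^+ 2.
      by rewrite ler_pM2l // lerXn2r ?nnegrE.
    have := lt_le_trans bS h; rewrite expr2.
    have : 0 <= L * #|S|%:R by rewrite mulr_ge0 // ltW.
    have : 0 <= d * (L * #|S|%:R) by rewrite !mulr_ge0 // ltW.
    lra.
  + move=> S bS; have := times_inner_ge S u01 p01; rewrite /bad in bS; lra.
Qed.

Lemma plus_concentration (R : realType) (n : nat) (u : 'I_n -> R) (p L c c' d eps eta Y : R) :
  (forall i, 0 <= u i <= 1) -> 0 < c <= 1 -> c * n%:R <= \sum_i u i -> c' = c ^+ 2 / 2 ->
  dense_regime n p L c' d eps -> 0 < eta -> 3 / eta <= L ->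
  Y = p / L * \sum_i u i ->
  1 - eta <= model_plus u p (fun G => (1 - d) * Y <= (chi G)%:R <= (1 + d) * Y).
Proof.
move=> u01 /andP[c0 c1] cu c'E reg eta0 etaL defY; rewrite /model_plus.
have err := error_le reg eta0 etaL.
have [p0 pd /andP[d0 d1] /andP[c'0 c'1] L3 dcL pn nL p4n _ _ _ _] := reg.
have L0 : 0 < L by lra.
have dL : 64 <= d * L.
  by apply: le_trans dcL _; rewrite ler_pM2r // -[leRHS]mulr1 ler_pM2l.
have p01 : 0 <= p <= 1 by apply/andP; split; lra.
have n0 : 0 < n%:R :> R by have := expR_gt0 L; rewrite -pn pmulr_rgt0.
have uu i j : 0 <= p * (u i + u j) <= 2 * p.
  have /andP[ui0 ui1] := u01 i; have /andP[uj0 uj1] := u01 j.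
  rewrite mulr_ge0 ?addr_ge0 ?(ltW p0) //= [2 * p]mulrC ler_pM2l //; lra.
have hq : edge_law (fun i j => p * (u i + u j)).
  by move=> i j; have /andP[h1 h2] := uu i j; rewrite h1 /=; lra.
have YE : L * Y = p * \sum_i u i by rewrite defY; field; rewrite gt_eqF.
have su0 : 0 <= \sum_i u i by apply: sumr_ge0 => i _; have /andP[] := u01 i.
have sun : \sum_i u i <= n%:R.
  have /andP[_] := sum_le_card [set: 'I_n] u01; rewrite cardsT card_ord.
  by under eq_bigl => i do rewrite in_setT.
have Y0 : 0 <= Y by rewrite defY mulr_ge0 // divr_ge0 // ltW.
apply: le_trans (_ : 1 - (expR (- n%:R) + expR (1 - 2 * L) + expR ((4 - d * L ^+ 2) / p)) <= _).
  by rewrite lerD2l lerN2.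
pose bad (S : {set 'I_n}) := (1 + d) * L < p * \sum_(i in S) u i.
apply: (graph_prob_ge_compl (B := fun G => (1 + d) * Y < (chi G)%:R)
  (C := fun G => [exists S, bad S && [disjoint inner S & G]])) => //.
- move=> G sG; rewrite -leNgt => up /(chi_ge_plus sG).
  rewrite up andbT -YE => h.
  have {}h : Y <= (1 + d) * (chi G)%:R by rewrite -(ler_pM2l L0); lra.
  have d1' : 0 <= 1 - d by lra.
  have := ler_wpM2l d1' h; have : 0 <= d * d * (chi G)%:R by rewrite !mulr_ge0 // ltW.
  lra.
- set k := color_size d Y; have k0 : (0 < k)%N by [].
  have [rk rinj rdec] := exists_rank u.
  pose blk i := (rk i %/ k)%N.
  have dec j l : (blk j < blk l)%N -> u l <= u j.
    move=> lt; apply: rdec; rewrite ltnNge; apply/negP => le.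
    by move: lt; rewrite ltnNge leq_div2r.
  have hblk (t : 'I_(n %/ k)) : #|block blk [set: 'I_n] t| = k by exact: card_block_rank.
  have w01 t := block_max_01 blk t u01.
  pose phi t t' := (1 + d / 16) * (p * (block_max u blk t + block_max u blk t')).
  apply: (chi_upper_regime (blk := blk) (phi := phi) reg) => //.
  + by move=> i j; have /andP[_ h] := uu i j.
  + by move=> i j; rewrite /phi [block_max u blk i + _]addrC.
  + move=> i j; apply: expR_opp_le; first by lra.
      have /andP[-> _] /= := uu i j.
      by rewrite ler_pM2l // lerD ?le_block_max.
    have /andP[h1 h2] := uu i j.
    have : (1 + d / 16) * (p * (u i + u j)) <= 2 * (2 * p) by apply: ler_pM => //; lra.
    lra.
  + move=> I; apply: pair_energy_le_sqr => t t'; rewrite /phi.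
    have /andP[w0 w1] := w01 t; have /andP[w0' w1'] := w01 t'.
    have W0 : 0 <= p * (block_max u blk t + block_max u blk t') by rewrite mulr_ge0 ?addr_ge0 // ltW.
    rewrite mulr_ge0 //=; last by lra.
    have h : p * (block_max u blk t + block_max u blk t') <= p * 2 by rewrite ler_pM2l //; lra.
    have : (1 + d / 16) * (p * (block_max u blk t + block_max u blk t')) <= 2 * (p * 2).
      by apply: ler_pM => //; lra.
    lra.
  + move=> I I0; apply: (plus_energy_le (k := k)) => //; first by rewrite d0.
      rewrite -YE; have h : (1 + d / 2) * Y <= k%:R by rewrite ltW // truncnS_gt.
      by have := ler_wpM2l (ltW L0) h; lra.
    have : p * (1 + d / 16) <= 1 * 2 by apply: ler_pM => //; lra.
    lra.
  + rewrite c'E [Y * L]mulrC YE; have := ler_wpM2l (ltW p0) cu.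
    (* One value of [c'] serves both models; as c <= 1, it lies below c, the constant natural to the
       sum model. *)
    have : c ^+ 2 / 2 * (p * n%:R) <= c * (p * n%:R).
      rewrite ler_pM2r ?mulr_gt0 //; have := ler_wpM2l (ltW c0) c1; rewrite expr2; lra.
    lra.
  + by rewrite [Y * L]mulrC YE ler_pM2l.
- apply: bad_indep_prob => //; first by lra.
  + move=> S bS; have /andP[S0 S1] := sum_le_card S u01.
    rewrite ler_pdivrMr //.
    have h : p * (\sum_(i in S) u i) <= p * #|S|%:R by rewrite ler_pM2l.
    have := lt_le_trans bS h.
    have : 0 <= d * L by rewrite mulr_ge0 // ltW.
    lra.
  + move=> S bS; have := plus_inner_ge S u01 p01; rewrite /bad in bS.
    have := ler_wpM2r (ler0n R #|S|) (ltW bS); lra.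
Qed.

(** * Thresholds for n *)

(** The fifth Taylor term suffices: (a L)^5 / 5! exceeds K L^4 once L >= 120 K / a^5. *)
Lemma poly_le_expR (R : realType) (a K : R) : 0 < a ->
  exists2 L0 : R, 1 <= L0 & forall L, L0 <= L -> K * L ^+ 4 <= expR (a * L).
Proof.
move=> a0; exists (Num.max 1 (K * 120 / a ^+ 5)); first by rewrite le_max lexx.
move=> L; rewrite ge_max => /andP[L1 KL].
have L0 : 0 < L by lra.
have fE : 5`!%:R = 120 :> R by [].
apply: le_trans (expR_ge1Dxn 4 (ltW (mulr_gt0 a0 L0))); rewrite fE.
rewrite ler_pdivrMr ?exprn_gt0 // in KL.
have := ler_wpM2r (exprn_ge0 4 (ltW L0)) KL.
have -> : (a * L) ^+ 5 = L * a ^+ 5 * L ^+ 4 by ring.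
lra.
Qed.

(** The main conditions compare a fixed power of L with an exponential in L, so one large [B],
    independent of [n] and [P], settles them all. [K] is a further lower bound on L, left free for
    the error term. *)
Lemma exists_regime_threshold (R : realType) (eps c d K : R) :
  0 < eps -> 0 < c <= 1 -> 0 < d <= 1 ->
  exists B : R, forall (n : nat) (P : R), expR (2 * B) <= n%:R -> P < d / 256 ->
    n%:R `^ (- (1 / 4) + eps) <= P ->
    dense_regime n P (ln (P * n%:R)) c d eps /\ K <= ln (P * n%:R).
Proof.
move=> eps0 c01 d01; have /andP[c0 c1] := c01; have /andP[d0 d1] := d01.
have c20 : 0 < c ^+ 2 by exact: exprn_gt0.
have [L1 L11 H1] := @poly_le_expR R (2 * eps) (expR 5 / c ^+ 2) (mulr_gt0 (ltr0n _ 2) eps0).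
have d32 : 0 < d / 16 / 2 by rewrite !divr_gt0.
have [L2 L21 H2] := @poly_le_expR R (d / 16 / 2) ((c ^+ 2)^-1) d32.
have [L3 L31 H3] := @poly_le_expR R (4 * eps) (4 / c) (mulr_gt0 (ltr0n _ 4) eps0).
have [L4 L41 H4] := @poly_le_expR R 1 (160 / (d * c ^+ 2)) ltr01.
have [B B0 [b1 b2 b3 b4 b5]] : exists2 B : R, 3 <= B &
    [/\ L1 <= B, L2 <= B, L3 <= B, L4 <= B & 64 / (d * c) <= B /\ K <= B].
  exists (Num.max L1 (Num.max L2 (Num.max L3 (Num.max L4 (Num.max 3 (Num.max (64 / (d * c)) K)))))).
    by rewrite !le_max lexx !orbT.
  by rewrite !le_max !lexx !orbT.
exists B => n P n1 Pd pln.
have n0 : 0 < n%:R :> R by apply: lt_le_trans n1; exact: expR_gt0.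
have pE : expR ((- (1 / 4) + eps) * ln n%:R) <= P.
  by move: pln; rewrite /powR gt_eqF.
pose lam := ln (n%:R : R); rewrite -/lam in pE.
have nE : n%:R = expR lam by rewrite lnK.
have P0 : 0 < P by apply: lt_le_trans pE; exact: expR_gt0.
have lamB : 2 * B <= lam by rewrite -ler_expR -nE.
have PN0 : 0 < P * n%:R by exact: mulr_gt0.
set L := ln (P * n%:R).
have LE : P * n%:R = expR L by rewrite lnK.
have lam0 : 0 < lam by lra.
have el0 : 0 <= eps * lam by rewrite mulr_ge0 // ltW.
(* As P n >= n^(3/4 + eps), L and ln n agree up to a constant factor, and largeness of n becomes
   largeness of L. *)
have Llam : 3 / 4 * lam <= L.
  rewrite -ler_expR -LE; apply: (@le_trans _ _ (expR ((- (1 / 4) + eps) * lam) * n%:R)).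
    by rewrite nE -expRD ler_expR; lra.
  by rewrite ler_pM2r.
have Lle : L <= lam.
  by rewrite -ler_expR -LE -nE -[leRHS]mul1r ler_pM2r //; lra.
have LB : B <= L by lra.
have L3' : 3 <= L by lra.
have L24 : L ^+ 2 <= L ^+ 4 by rewrite ler_eXn2l //; lra.
have [b51 b52] := b5.
split; last exact: le_trans LB.
split => //.
- lra.
- by have := le_trans b51 LB; rewrite ler_pdivrMr ?mulr_gt0 // [L * _]mulrC.
- by rewrite nE ler_expR; lra.
(* The fourth power cancels the exponent -1/4 against n and leaves n^(4 eps) >= e^(4 eps L). *)
- apply: (@le_trans _ _ (expR ((- (1 / 4) + eps) * lam) ^+ 4 * n%:R)); last first.
    by rewrite ler_pM2r // lerXn2r ?nnegrE ?expR_ge0 // ltW.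
  rewrite -expRM_natr nE -expRD ler_expR.
  by have := ler_wpM2l (ltW eps0) Lle; lra.
- by have := H1 L (le_trans b1 LB); rewrite mulrAC ler_pdivrMr // [_ * c ^+ 2]mulrC.
- have := H2 L (le_trans b2 LB); rewrite mulrC ler_pdivrMr // [_ * c ^+ 2]mulrC.
  by rewrite [d / 16 * L / 2]mulrAC.
- have := H3 L (le_trans b3 LB); rewrite mulrAC ler_pdivrMr // [_ * c]mulrC => h.
  by apply: le_trans h; rewrite ler_pM2l.
- have := H4 L (le_trans b4 LB); rewrite mulrAC ler_pdivrMr ?mulr_gt0 // mul1r [expR L * _]mulrC => h.
  by apply: le_trans h; rewrite ler_pM2l.
Qed.

Lemma regime_eventually (R : realType) (eps c d K : R) (p : nat -> R) :
  0 < eps -> 0 < c <= 1 -> 0 < d <= 1 ->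
  (p @ \oo --> (0 : R))%classic ->
  (\forall n \near \oo, n%:R `^ (- (1 / 4) + eps) <= p n)%classic ->
  (\forall n \near \oo, dense_regime n (p n) (ln (p n * n%:R)) c d eps /\
     K <= ln (p n * n%:R))%classic.
Proof.
move=> eps0 c01 d01 ps pl; have [B hB] := exists_regime_threshold K eps0 c01 d01.
have d0 : 0 < d / 256 by have /andP[d0 _] := d01; rewrite divr_gt0.
have pk : (\forall n \near \oo, `|p n| < d / 256)%classic by exact: cvgr0_norm_lt ps _ d0.
have nB : (\forall n \near \oo, expR (2 * B) <= n%:R)%classic by exact: nbhs_infty_ger.
apply: filterS3 pl pk nB => n pln pkn nBn; apply: hB => //.
exact: le_lt_trans (ler_norm _) pkn.
Qed.

Local Open Scope classical_set_scope.
Local Open Scope ring_scope.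

Theorem theorem1p4 (R : realType) (eps : R) (eps_gt0 : 0 < eps)
    (p : nat -> R) (p_small : p @ \oo --> (0 : R))
    (p_large : \forall n \near \oo, n%:R `^ (- (1 / 4) + eps) <= p n) :
  forall c delta eta : R, 0 < c -> 0 < delta -> 0 < eta ->
  \forall n \near \oo, forall u : 'I_n -> R,
    (forall i, 0 <= u i <= 1) -> c * n%:R <= \sum_(i < n) u i ->
    (let Y := p n / (2 * ln (p n * n%:R)) * max_density u in
     1 - eta <= model_times u (p n)
       (fun G => (1 - delta) * Y <= (chi G)%:R <= (1 + delta) * Y)) /\
    (let Y := p n / ln (p n * n%:R) * \sum_(i < n) u i in
     1 - eta <= model_plus u (p n)
       (fun G => (1 - delta) * Y <= (chi G)%:R <= (1 + delta) * Y)).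
Proof.
move=> c delta eta c0 delta0 eta0.
(* The regime asks for constants at most 1. Lowering c weakens the condition on u, and [widen]
   returns from d to delta. *)
pose c1 := Num.min c 1; pose d := Num.min delta 1.
have c1E : 0 < c1 <= 1 by rewrite lt_min c0 ltr01 /= ge_min lexx orbT.
have dE : 0 < d <= 1 by rewrite lt_min delta0 ltr01 /= ge_min lexx orbT.
have [c10 c11] := andP c1E.
have c'E : 0 < c1 ^+ 2 / 2 <= 1.
  have : c1 ^+ 2 <= 1 by rewrite exprn_ile1 // ltW.
  by rewrite divr_gt0 ?exprn_gt0 //=; lra.
have dd : d <= delta by rewrite ge_min lexx.
(* The regime does not mention the weights, so one threshold for n serves all u; this is the
   uniformity. *)
have := regime_eventually (3 / eta) eps_gt0 c'E dE p_small p_large.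
apply: filterS => n [reg etaL] u u01 cu.
have cu1 : c1 * n%:R <= \sum_i u i.
  by apply: le_trans cu; rewrite ler_wpM2r // ge_min lexx.
have [p0 pd _ _ L3 _ _ _ _ _ _ _ _] := reg.
have L0 : 0 < ln (p n * n%:R) by lra.
have widen Y k : 0 <= Y -> (1 - d) * Y <= k <= (1 + d) * Y -> (1 - delta) * Y <= k <= (1 + delta) * Y.
  move=> Y0 /andP[h1 h2]; have := ler_wpM2r Y0 dd; rewrite !mulrDl in h1 h2 *.
  by move=> h; apply/andP; split; lra.
have /andP[d0 d1] := dE.
split.
  apply: le_trans (times_concentration u01 c10 cu1 erefl reg eta0 etaL erefl) _.
  apply: graph_prob_le => [i j|G _].
    have /andP[ui0 ui1] := u01 i; have /andP[uj0 uj1] := u01 j.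
    rewrite !mulr_ge0 ?(ltW p0) //= !mulr_ile1 ?mulr_ge0 ?(ltW p0) //; lra.
  apply: widen; rewrite mulr_ge0 ?divr_ge0 ?mulr_ge0 ?(ltW p0) ?(ltW L0) //.
  exact: max_density_ge0.
apply: le_trans (plus_concentration u01 c1E cu1 erefl reg eta0 etaL erefl) _.
apply: graph_prob_le => [i j|G _].
  have /andP[ui0 ui1] := u01 i; have /andP[uj0 uj1] := u01 j.
  rewrite mulr_ge0 ?(ltW p0) ?addr_ge0 //=.
  have : p n * (u i + u j) <= p n * 2 by rewrite ler_pM2l //; lra.
  lra.
apply: widen; rewrite mulr_ge0 ?divr_ge0 ?(ltW p0) ?(ltW L0) //.
by apply: sumr_ge0 => i _; have /andP[] := u01 i.
Qed.
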